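(* Let $n\geq 1$. The space of Kähler functions on $\mathbb{P}_1(\tfrac1n)\cong S^2$ is spanned by the coordinate functions $x,y,z$ and the constant function $1$. Regard $S^2\cong\mathbb{P}_1(\frac1n)$ as a regular torification of the family $\mathcal{B}(n)$ of binomial distributions. If $\alpha,\beta,\gamma,\delta$ are real numbers, then the spectrum of $f(x,y,z)=\alpha x+\beta y+\gamma z+\delta$ is given by $$\mathrm{spec}(f)=\Big\{\tfrac{2}{n}\|(\alpha,\beta,\gamma)\|\Big(-\tfrac n2+k\Big)+\delta\;\Big|\;k=0,1,\dots,n\Big\},$$ where $\|\cdot\|$ is the Euclidean norm on $\mathbb{R}^3$. In particular, if $\|(\alpha,\beta,\gamma)\|=\tfrac n2=:j$ and $\delta=0$, then $\mathrm{spec}(f)=\{-j,-j+1,\dots,j-1,j\}$.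
   Context: $\mathcal{B}(n)$ is the set of binomial distributions $p(k)=\binom nkq^k(1-q)^{n-k}$, $q\in(0,1)$, on $\Omega=\{0,1,\dots,n\}$. It is a $1$-dimensional exponential family: $p_\theta(k)=\exp(C(k)+\theta F(k)-\psi(\theta))$ with $\theta=\ln\frac{q}{1-q}$, $C(k)=\ln\binom nk$, $F(k)=k$, $\psi(\theta)=n\ln(1+e^\theta)$. Here $F$ is injective and $\mathcal{A}_{\mathcal{E}}$, the span of $F$ and $1$, is the space of functions $k\mapsto ak+b$, $a,b\in\mathbb{R}$. The closure of $\mathcal{B}(n)$ for pointwise convergence is $\overline{\mathcal{B}(n)}=\mathcal{B}(n)\cup\{\delta_0,\delta_n\}$ with $\delta_i(j)=1$ if $i=j$, $0$ otherwise. $\mathbb{E}_p(X)=\sum_kX(k)p(k)$. General definitions. For an exponential family $\mathcal{E}=\{p_\theta\}_{\theta\in\mathbb{R}^d}$ over a finite set, with Fisher metric $(h_F)_{ij}(\theta)=\mathbb{E}_{p_\theta}(\partial_i\ln p_\theta\,\partial_j\ln p_\theta)$ and the flat connection $\nabla^{(e)}$ having $\theta$ as affine coordinates, $T\mathcal{E}$ (coordinates $(\theta,\dot\theta)$ for $\sum\dot\theta_k\partial/\partial\theta_k|_{p_\theta}$) is Kähler with holomorphic coordinates $z_k=\theta_k+i\dot\theta_k$ and metric $\mathrm{diag}(h_F(\theta),h_F(\theta))$. A parallel lattice $L$ is the set of integer combinations of a frame $Y=(Y_1,\dots,Y_d)$ of $\nabla^{(e)}$-parallel vector fields (a generator); $\Gamma(L)$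 is the group of translations $u\mapsto u+\sum k_iY_i$, $k_i\in\mathbb{Z}$, $\mathcal{E}_L=T\mathcal{E}/\Gamma(L)$ with quotient map $q_L$ and projection $\pi_L:\mathcal{E}_L\to\mathcal{E}$, with torus action $\Phi_Y([t],q_L(u))=q_L(u+\sum t_iY_i)$ of $\mathbb{T}^d=\mathbb{R}^d/\mathbb{Z}^d$. A connected Kähler manifold $N$ of complex dimension $d$ with effective holomorphic isometric $\mathbb{T}^d$-action, free locus $N^\circ$, is a torification of $\mathcal{E}$ if there are such $L,Y$ and an equivariant holomorphic isometric diffeomorphism $G:\mathcal{E}_L\to N^\circ$; it is regular if moreover $N$ is simply connected, complete, with real-analytic metric. The maps $\kappa=\pi_L\circ G^{-1}$ so obtained are the compatible projections; when $N$ is compact each has a unique continuous extension $K:N\to\overline{\mathcal{E}}$ (its natural extension), $\overline{\mathcal{E}}$ being the closure of $\mathcal{E}$ in the set of all probability functions. $\mathbb{P}_1(\frac1n)$ is the complex projective line with Fubini–Study metric of holomorphic sectional curvature $\frac1n$, with action $\Phi([t],[z_1,z_2])=[e^{2i\pi t}z_1,z_2]$ of $\mathbb{T}^1$; it is a regular torification of $\mathcal{B}(n)$. The unit sphere $S^2\subset\mathbb{R}^3$ is identified with $\mathbb{P}_1(\frac1n)$ via $(\cos a\sin b,\sin a\sin b,\cos b)\mapsto[\cos(b/2)e^{ia},\sin(b/2)]$, $a\in[0,2\pi]$, $b\in[0,\pi]$; the Kähler metric on $S^2$ is then $n$ times the round metric induced from $\mathbb{R}^3$, the identity component of the group of holomorphic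 isometries is $SO(3)$, and $K(x,y,z)(k)=2^{-n}\binom nk(1+z)^k(1-z)^{n-k}$ (with $0^0=1$) is the natural extension of a compatible projection. Kähler functions and spectrum. A smooth $f:N\to\mathbb{R}$ on a Kähler manifold is Kähler if its Hamiltonian vector field is Killing. When $N$ is a Kähler toric manifold that is a regular torification of $\mathcal{E}$ and the map $F$ is injective, every Kähler function can be written $f(p)=\mathbb{E}_{K(\phi(p))}(X)$ for all $p\in N$, with $X\in\mathcal{A}_{\mathcal{E}}$, $\phi$ in the identity component of the group of holomorphic isometries of $N$, and $K$ the natural extension of a compatible projection; $\mathrm{spec}(f)$ is defined as the image of $X$, which does not depend on the choice of $K,\phi,X$. *)

(* Defs.v *)
From HB Require Import structures.
From mathcomp Require Import all_boot all_order all_algebra.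
From mathcomp Require Import all_classical all_reals all_analysis.
From mathcomp Require Import ring lra.

Set Implicit Arguments.
Unset Strict Implicit.
Unset Printing Implicit Defensive.

Import Order.TTheory GRing.Theory Num.Theory.
Import numFieldNormedType.Exports.

Local Open Scope classical_set_scope.
Local Open Scope ring_scope.

(* [V] is meant to be finite dimensional: then [Cn k f] is the usual C^k
   condition, [f] being C^(k+1) iff it is differentiable and all its directional
   derivatives are C^k. *)
Fixpoint Cn {R : realType} {V W : normedModType R} (k : nat) (f : V -> W) : Prop :=
  match k with
  | 0 => continuous f
  | k'.+1 => (forall x, differentiable f x) /\ (forall v, Cn k' ('D_v f))
  end.

Definition smooth {R : realType} {V W : normedModType R} (f : V -> W) : Prop :=
  forall k, Cn k f.

Section Sphere.
Context {R : realType}.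
Implicit Types u v w : 'rV[R]_3.

Definition row3 (a b c : R) : 'rV[R]_3 := \row_i [:: a; b; c]`_i.
Definition cx v : R := v 0 0.
Definition cy v : R := v 0 1.
Definition cz v : R := v 0 2%:R.

Definition dot u v : R := \sum_i u 0 i * v 0 i.
Definition cross u v : 'rV[R]_3 :=
  row3 (cy u * cz v - cz u * cy v)
       (cz u * cx v - cx u * cz v)
       (cx u * cy v - cy u * cx v).

Lemma cx_row3 a b c : cx (row3 a b c) = a.
Proof. by rewrite /cx mxE. Qed.
Lemma cy_row3 a b c : cy (row3 a b c) = b.
Proof. by rewrite /cy mxE. Qed.
Lemma cz_row3 a b c : cz (row3 a b c) = c.
Proof. by rewrite /cz mxE. Qed.

Lemma dotE u v : dot u v = cx u * cx v + cy u * cy v + cz u * cz v.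
Proof.
rewrite /dot !big_ord_recr big_ord0 /= add0r /cx /cy /cz.
by congr (_ + _ + _); congr (_ * _); congr (_ _ _); apply: val_inj.
Qed.

Definition sphere : set 'rV[R]_3 := [set v | dot v v = 1].

End Sphere.

(* Carries the subspace topology of 'rV[R]_3. *)
Notation S2 R := (set_type (@sphere R)).

Section KahlerSphere.
Context {R : realType}.
Implicit Types (p : S2 R) (u v : 'rV[R]_3).

Definition mkS2 v (h : dot v v = 1) : S2 R := SigSub (mem_set h).

Lemma dot_S2 p : dot (val p) (val p) = 1.
Proof. by case: p => v /= /set_mem. Qed.

Lemma north_subproof : dot (row3 0 0 1) (row3 0 0 1) = 1 :> R.
Proof. by rewrite dotE !cx_row3 !cy_row3 !cz_row3; ring. Qed.
Definition north : S2 R := mkS2 north_subproof.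

(* Radial retraction onto the sphere; the value at 0 is irrelevant. *)
Definition radial v : S2 R := insubd north ((Num.sqrt (dot v v))^-1 *: v).

Definition tangent p u : Prop := dot (val p) u = 0.

Definition S2_smooth {W : normedModType R} (f : S2 R -> W) : Prop :=
  exists F : 'rV[R]_3 -> W, smooth F /\ forall p, f p = F (val p).

(* df_p(u), as the derivative of [f] at time 0 along a curve on the sphere that
   starts at [p] with velocity [u]. *)
Definition S2_diff {W : normedModType R} (f : S2 R -> W) p u : W :=
  derive1 (fun t : R => f (radial (val p + t *: u))) 0.

Definition S2_dmap (phi : S2 R -> S2 R) p u : 'rV[R]_3 :=
  S2_diff (fun q => val (phi q)) p u.

Variable n : nat.

(* The Kaehler structure transported from the projective line by
   (cos a sin b, sin a sin b, cos b) |-> [cos(b/2) e^(ia), sin(b/2)]; see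
   [stereo_J] and [stereo_metric] below. *)
Definition metric p u v : R := n%:R * dot u v.
Definition J p u : 'rV[R]_3 := cross u (val p).
Definition kform p u v : R := metric p (J p u) v.

(* Affine coordinate w = z1 / z2 = cot(b/2) e^(ia) = (x + i y) / (1 - z) of the
   projective line, where the Fubini-Study metric of holomorphic sectional
   curvature 1/n is 4 n |dw|^2 / (1 + |w|^2)^2. *)
Definition stereo_re v : R := cx v / (1 - cz v).
Definition stereo_im v : R := cy v / (1 - cz v).

Lemma is_derive_coord (i : 'I_3) v u :
  is_derive v u (fun w : 'rV[R]_3 => w 0 i : R) (u 0 i).
Proof.
have dc : differentiable (fun w : 'rV[R]_3 => w 0 i : R) v.
  exact: differentiable_coord.
apply: DeriveDef; first exact: diff_derivable.
rewrite /derive; apply: cvg_lim => //.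
apply: (@cvg_near_cst _ _ _ _ _ _ _); near=> h.
rewrite /= !mxE addrK /GRing.scale /= mulrA mulVf ?mul1r//.
by near: h; exact: nbhs_dnbhs_neq.
Unshelve. all: by end_near. Qed.

Lemma derive_stereo (a : 'rV[R]_3 -> R) v u da : is_derive v u a da ->
  cz v != 1 ->
  'D_u (fun w => a w / (1 - cz w)) v =
  da / (1 - cz v) + a v * cz u / (1 - cz v) ^+ 2.
Proof.
move=> ha hz; have nz : 1 - cz v != 0 by rewrite subr_eq0 eq_sym.
have hc : is_derive v u (fun w => 1 - cz w) (- cz u).
  rewrite -[- cz u]add0r; apply: is_deriveB; exact: is_derive_coord.
have hd : derivable (fun w => (1 - cz w)^-1) v u by apply: derivableV.
have := @deriveM _ _ a (fun w => (1 - cz w)^-1) v u _ hd.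
rewrite /GRing.mul_fun => -> //; rewrite deriveV// !derive_val.
by rewrite /GRing.scale /=; field.
Qed.

Lemma derive_stereo_re v u : cz v != 1 -> 'D_u stereo_re v =
  cx u / (1 - cz v) + cx v * cz u / (1 - cz v) ^+ 2.
Proof. by apply: derive_stereo; exact: is_derive_coord. Qed.

Lemma derive_stereo_im v u : cz v != 1 -> 'D_u stereo_im v =
  cy u / (1 - cz v) + cy v * cz u / (1 - cz v) ^+ 2.
Proof. by apply: derive_stereo; exact: is_derive_coord. Qed.

Lemma stereo_J p u : cz (val p) != 1 -> tangent p u ->
  'D_(J p u) stereo_re (val p) = - 'D_u stereo_im (val p) /\
  'D_(J p u) stereo_im (val p) = 'D_u stereo_re (val p).
Proof.
move=> hz; have := dot_S2 p; rewrite /tangent !dotE => hp hu.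
have nz : 1 - cz (val p) != 0 by rewrite subr_eq0 eq_sym.
rewrite !derive_stereo_re// !derive_stereo_im// /J /cross.
rewrite cx_row3 cy_row3 cz_row3.
set x := cx (val p) in hp hu *; set y := cy (val p) in hp hu *.
set z := cz (val p) in nz hp hu *.
set S := x * x + y * y + z * z in hp.
set T := x * cx u + y * cy u + z * cz u in hu.
split; apply/eqP; rewrite -subr_eq0; apply/eqP.
  transitivity ((cy u * (1 - S) + y * T) / (1 - z) ^+ 2).
    by rewrite /S /T; field.
  by rewrite hp hu; ring.
transitivity ((- cx u * (1 - S) - x * T) / (1 - z) ^+ 2).
  by rewrite /S /T; field.
by rewrite hp hu; ring.
Qed.

Lemma stereo_metric p u v :
  cz (val p) != 1 -> tangent p u -> tangent p v ->
  metric p u v =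
  4 * n%:R * ('D_u stereo_re (val p) * 'D_v stereo_re (val p) +
              'D_u stereo_im (val p) * 'D_v stereo_im (val p))
  / (1 + stereo_re (val p) ^+ 2 + stereo_im (val p) ^+ 2) ^+ 2.
Proof.
move=> hz; have := dot_S2 p; rewrite /tangent !dotE => hp hu hv.
have nz : 1 - cz (val p) != 0 by rewrite subr_eq0 eq_sym.
rewrite !derive_stereo_re// !derive_stereo_im// /metric dotE.
rewrite /stereo_re /stereo_im.
set x := cx (val p) in hp hu hv *; set y := cy (val p) in hp hu hv *.
set z := cz (val p) in nz hp hu hv *.
have -> : 1 + (x / (1 - z)) ^+ 2 + (y / (1 - z)) ^+ 2 = 2 / (1 - z).
  transitivity (((1 - z) ^+ 2 + (x * x + y * y + z * z) - z * z) / (1 - z) ^+ 2).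
    by field.
  by rewrite hp; field.
set S := x * x + y * y + z * z in hp.
set T := x * cx u + y * cy u + z * cz u in hu.
set T' := x * cx v + y * cy v + z * cz v in hv.
apply/eqP; rewrite -subr_eq0; apply/eqP.
transitivity (n%:R / (1 - z) ^+ 2 * (cz u * cz v * (1 - S)
  - (1 - z) * cz v * T - (1 - z) * cz u * T')).
  by rewrite /S /T /T'; field.
by rewrite hp hu hv; ring.
Qed.

Definition vector_field (X : S2 R -> 'rV[R]_3) : Prop :=
  forall p, tangent p (X p).

Definition hamiltonian_field (f : S2 R -> R) (X : S2 R -> 'rV[R]_3) : Prop :=
  vector_field X /\
  forall p u, tangent p u -> kform p (X p) u = S2_diff f p u.

(* Levi-Civita connection of an embedded submanifold: tangential part of the
   ambient derivative (a constant factor in the metric does not change it). *)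
Definition nabla (X : S2 R -> 'rV[R]_3) p u : 'rV[R]_3 :=
  S2_diff X p u - dot (S2_diff X p u) (val p) *: val p.

(* (L_X g)(u, v) = g(nabla_u X, v) + g(u, nabla_v X) *)
Definition killing (X : S2 R -> 'rV[R]_3) : Prop :=
  [/\ vector_field X, S2_smooth X &
   forall p u v, tangent p u -> tangent p v ->
     metric p (nabla X p u) v + metric p u (nabla X p v) = 0].

Definition kahler_function (f : S2 R -> R) : Prop :=
  S2_smooth f /\ exists X, hamiltonian_field f X /\ killing X.

Definition holomorphic_isometry : set (S2 R -> S2 R) :=
  [set phi |
    [/\ S2_smooth (fun p => val (phi p)),
        (exists psi : S2 R -> S2 R,
          [/\ S2_smooth (fun p => val (psi p)), cancel phi psi & cancel psi phi]),
        (forall p u v, tangent p u -> tangent p v ->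
          metric (phi p) (S2_dmap phi p u) (S2_dmap phi p v) = metric p u v) &
        (forall p u, tangent p u ->
          S2_dmap phi p (J p u) = J (phi p) (S2_dmap phi p u))]].

Definition identity_component : set (S2 R -> S2 R) :=
  connected_component
    (holomorphic_isometry : set {compact-open, S2 R -> S2 R}) id.

Definition rotz (t : R) v : 'rV[R]_3 :=
  row3 (cos t * cx v - sin t * cy v) (sin t * cx v + cos t * cy v) (cz v).

Lemma torus_act_subproof (t : R) p :
  dot (rotz t (val p)) (rotz t (val p)) = 1.
Proof.
rewrite -(dot_S2 p) !dotE /rotz !cx_row3 !cy_row3 !cz_row3.
have h := cos2Dsin2 t.
transitivity ((cos t ^+ 2 + sin t ^+ 2) * (cx (val p) ^+ 2 + cy (val p) ^+ 2)
  + cz (val p) ^+ 2); first by ring.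
by rewrite h; ring.
Qed.

(* Phi([t], [z1, z2]) = [e^(2 i pi t) z1, z2]; [t : R] stands for its class
   in R/Z. *)
Definition torus_act (t : R) p : S2 R :=
  mkS2 (torus_act_subproof (2 * pi * t) p).

Definition free_locus : set (S2 R) :=
  [set p | forall t, torus_act t p = p -> t \is a Num.int].

End KahlerSphere.

Section Families.
Context {R : realType}.

Definition expectation {T : finType} (p X : T -> R) : R := \sum_k X k * p k.

(* Fisher metric of a one-parameter family, E_p((d/dtheta ln p)^2) *)
Definition fisher {T : finType} (p : R -> T -> R) (theta : R) : R :=
  expectation (p theta) (fun k => (derive1 (fun s => ln (p s k)) theta) ^+ 2).

Variable n : nat.

Definition Fstat (k : 'I_n.+1) : R := k%:R.

Definition binomial_exp (theta : R) (k : 'I_n.+1) : R :=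
  expR (ln ('C(n, k)%:R) + theta * Fstat k - n%:R * ln (1 + expR theta)).

Definition binomial_family : set ('I_n.+1 -> R) :=
  [set p : 'I_n.+1 -> R | exists q : R, 0 < q < 1 /\ forall k, p k = binomial_pmf n q k].

Lemma binomial_expE (q : R) (k : 'I_n.+1) : 0 < q < 1 ->
  binomial_exp (ln (q / (1 - q))) k = binomial_pmf n q k.
Proof.
move=> /andP[q0 q1]; have q1' : 0 < 1 - q by rewrite subr_gt0.
have C0 : 0 < 'C(n, k)%:R :> R by rewrite ltr0n bin_gt0 -ltnS ltn_ord.
have d0 : 0 < q / (1 - q) by rewrite divr_gt0.
rewrite /binomial_exp /Fstat lnK ?posrE//.
have -> : 1 + q / (1 - q) = (1 - q)^-1.
  by field; rewrite gt_eqF.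
rewrite lnV ?posrE// mulrN opprK !expRD lnK ?posrE// expRM_natr lnK ?posrE//.
rewrite expRM_natl lnK ?posrE//.
have kn : (k <= n)%N by rewrite -ltnS ltn_ord.
rewrite /binomial_pmf /unstable.onem -[in X in _ * (1 - q) ^+ X](subnKC kn) exprD.
rewrite expr_div_n -mulr_natl; field.
by rewrite expf_neq0// gt_eqF.
Qed.

Lemma binomial_familyE : binomial_family = range binomial_exp.
Proof.
apply/seteqP; split => [p [q [q01 pE]]|_ [theta _ <-]].
  exists (ln (q / (1 - q))) => //.
  by apply/funext => k; rewrite binomial_expE// pE.
have e0 := expR_gt0 theta.
have q01 : 0 < expR theta / (1 + expR theta) < 1.
  rewrite divr_gt0 ?addr_gt0//= ltr_pdivrMr ?addr_gt0// mul1r; lra.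
exists (expR theta / (1 + expR theta)); split => //.
move=> k; rewrite -binomial_expE//; congr binomial_exp.
rewrite -[LHS]expRK; congr ln; field.
by rewrite !gt_eqF//; lra.
Qed.

Definition affine_observable (X : 'I_n.+1 -> R) : Prop :=
  exists a b : R, forall k, X k = a * Fstat k + b.

(* The tangent bundle of the binomial family is R * R, with coordinates
   (theta, theta'); [c] is the generator c d/dtheta of the parallel lattice, and
   [G] is the composition of the isomorphism TE/Gamma(L) -> free locus with the
   quotient map TE -> TE/Gamma(L).  A smooth bijection of surfaces that is
   isometric has invertible differentials, hence is a diffeomorphism. *)
Record torification (c : R) (G : R * R -> S2 R) : Prop := Torification {
  tor_gen : c != 0;
  tor_smooth : smooth (fun u : R * R => val (G u) : 'rV[R]_3);
  tor_fiber : forall u v : R * R,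
    G u = G v <-> exists m : int, v = (u.1, u.2 + m%:~R * c);
  tor_image : range G = free_locus;
  tor_isometric : forall u a b : R * R,
    metric n (G u) ('D_a (fun w => val (G w)) u) ('D_b (fun w => val (G w)) u)
    = fisher binomial_exp u.1 * (a.1 * b.1 + a.2 * b.2);
  tor_holomorphic : forall u a : R * R,
    'D_(- a.2, a.1) (fun w => val (G w)) u = J (G u) ('D_a (fun w => val (G w)) u);
  tor_equivariant : forall (t : R) (u : R * R),
    G (u.1, u.2 + t * c) = torus_act t (G u) }.

(* [K] restricts to the compatible projection pi_L o G^-1 on the free locus. *)
Definition natural_extension (K : S2 R -> 'I_n.+1 -> R) : Prop :=
  [/\ continuous (K : S2 R -> {ptws 'I_n.+1 -> R}),
      (forall p, closure (binomial_family : set {ptws 'I_n.+1 -> R}) (K p)) &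
      exists c G, torification c G /\ forall u, K (G u) = binomial_exp u.1].

Definition spectral_rep (f : S2 R -> R) (K : S2 R -> 'I_n.+1 -> R)
    (phi : S2 R -> S2 R) (X : 'I_n.+1 -> R) : Prop :=
  [/\ natural_extension K, identity_component n phi, affine_observable X &
      forall p, f p = expectation (K (phi p)) X].

Definition is_spec (f : S2 R -> R) (A : set R) : Prop :=
  (exists K phi X, spectral_rep f K phi X) /\
  (forall K phi X, spectral_rep f K phi X -> range X = A).

End Families.

(* Main.v *)
(* A Killing field X of the sphere has constant component on the velocity of any
   great circle; comparing the ends of the great circle through p and q gives
   <X p, q> + <X q, p> = 0, so X is the restriction of a skew linear map, i.e.
   X p = w x p. If X is the Hamiltonian field of f, then f + n <w, .> has zero
   differential, so f is affine.

   The spectrum of f = <A, .> + d needs no uniqueness of K, phi or X: phi is onto,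
   and every compatible projection is onto the family, so f fills (up to end
   points) the interval of the means of X = a k + b, which has end points b and
   b + a n. Comparing with f(S^2) = [d - |A|, d + |A|] determines a and b up to
   the symmetry k |-> n - k. A representation exists because a rotation takes
   A / |A| to the north pole, and the mean of k under K(x, y, z) is
   n (1 + z) / 2. *)

Require Import Defs.
From HB Require Import structures.
From mathcomp Require Import all_boot all_order all_algebra.
From mathcomp Require Import all_classical all_reals all_analysis.
From mathcomp Require Import ring lra zify.

Set Implicit Arguments.
Unset Strict Implicit.
Unset Printing Implicit Defensive.

Import Order.TTheory GRing.Theory Num.Theory.
Import numFieldNormedType.Exports.

Local Open Scope classical_set_scope.
Local Open Scope ring_scope.

(** * Coordinates, dot product and cross product in three-space *)

Section VectorAlgebra.
Context {R : realType}.
Implicit Types (u v w : 'rV[R]_3) (a : R).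

Lemma row3P u v : cx u = cx v -> cy u = cy v -> cz u = cz v -> u = v.
Proof.
move=> hx hy hz; apply/rowP => -[[|[|[|//]]] hi].
- by move: hx; rewrite /cx; congr (_ = _); congr (_ _ _); apply: val_inj.
- by move: hy; rewrite /cy; congr (_ = _); congr (_ _ _); apply: val_inj.
- by move: hz; rewrite /cz; congr (_ = _); congr (_ _ _); apply: val_inj.
Qed.

Lemma coordD u v : (cx (u + v) = cx u + cx v) * (cy (u + v) = cy u + cy v)
  * (cz (u + v) = cz u + cz v).
Proof. by rewrite /cx /cy /cz !mxE. Qed.

Lemma coordN u : (cx (- u) = - cx u) * (cy (- u) = - cy u) * (cz (- u) = - cz u).
Proof. by rewrite /cx /cy /cz !mxE. Qed.

Lemma coordZ a u : (cx (a *: u) = a * cx u) * (cy (a *: u) = a * cy u)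
  * (cz (a *: u) = a * cz u).
Proof. by rewrite /cx /cy /cz !mxE. Qed.

Lemma coord_cross u v :
  (cx (cross u v) = cy u * cz v - cz u * cy v)
  * (cy (cross u v) = cz u * cx v - cx u * cz v)
  * (cz (cross u v) = cx u * cy v - cy u * cx v).
Proof. by rewrite /cross cx_row3 cy_row3 cz_row3. Qed.

Definition coordE :=
  (@cx_row3 R, @cy_row3 R, @cz_row3 R, coordD, coordN, coordZ, coord_cross).

Lemma dotC u v : dot u v = dot v u.
Proof. by rewrite !dotE; ring. Qed.

Lemma dotDr w u v : dot w (u + v) = dot w u + dot w v.
Proof. by rewrite !dotE !coordE; ring. Qed.

Lemma dotZr a w u : dot w (a *: u) = a * dot w u.
Proof. by rewrite !dotE !coordE; ring. Qed.

Lemma dotNr w u : dot w (- u) = - dot w u.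
Proof. by rewrite !dotE !coordE; ring. Qed.

Lemma dotDl w u v : dot (u + v) w = dot u w + dot v w.
Proof. by rewrite !dotE !coordE; ring. Qed.

Lemma dotZl a w u : dot (a *: u) w = a * dot u w.
Proof. by rewrite !dotE !coordE; ring. Qed.

Lemma dot_ge0 u : 0 <= dot u u.
Proof. by rewrite dotE -!expr2 !addr_ge0// sqr_ge0. Qed.

Lemma dot_eq0 u : dot u u = 0 -> u = 0.
Proof.
rewrite dotE => h; have hx := sqr_ge0 (cx u); have hy := sqr_ge0 (cy u).
have hz := sqr_ge0 (cz u).
have h0 : forall i, (0 : 'rV[R]_3) 0 i = 0 by move=> i; rewrite mxE.
by apply: row3P; rewrite [RHS]h0; apply/eqP; rewrite -sqrf_eq0; apply/eqP;
  lra.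
Qed.

Lemma val_mkS2 v (h : dot v v = 1) : val (mkS2 h) = v.
Proof. by []. Qed.

(** A vector of positive norm rescales to a unit vector, so the default point of [insubd] does not
    appear. *)
Lemma val_radial v : 0 < dot v v ->
  val (radial v) = (Num.sqrt (dot v v))^-1 *: v.
Proof.
move=> v0; rewrite /radial val_insubd ifT//; apply/mem_set.
rewrite /sphere /= dotZl dotZr mulrA -invfM -expr2 sqr_sqrtr ?ltW//.
by rewrite mulVf// gt_eqF.
Qed.

(** [acos x] has cosine [x] and sine |y|; the sign of [y] decides between this angle and its
    opposite. *)
Lemma exists_angle (x y : R) : x ^+ 2 + y ^+ 2 = 1 ->
  exists t : R, cos t = x /\ sin t = y.
Proof.
move=> h; have y0 := sqr_ge0 y; have x0 := sqr_ge0 x.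
have x1 : -1 <= x <= 1 by rewrite -ler_norml -(@expr_le1 _ 2)// real_normK ?num_real//; lra.
have hs : sin (acos x) = `|y|.
  by rewrite sin_acos// -sqrtr_sqr; congr Num.sqrt; lra.
have hc : cos (acos x) = x by rewrite acosK// in_itv.
have [yp|yn] := lerP 0 y.
  by exists (acos x); split=> //; rewrite hs ger0_norm.
by exists (- acos x); rewrite cosN sinN hc hs ltr0_norm// opprK.
Qed.

End VectorAlgebra.

(** * Derivatives along curves on the sphere, and great circles *)

Section Calculus.
Context {R : realType}.

(** The chain rule for differentials, read through directional derivatives; a curve that is
    derivable is differentiable because its source is one-dimensional. *)
Lemma is_derive_along (V W : normedModType R) (F : V -> W) (g : R -> V) (t : R) (dg : V) :
  differentiable F (g t) -> is_derive t 1 g dg ->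
  is_derive t 1 (fun s => F (g s)) ('D_dg F (g t)).
Proof.
move=> dF [dg1 dgE]; have dgt : differentiable g t by apply/derivable1_diffP.
have dFg : differentiable (F \o g) t by apply: differentiable_comp.
apply: DeriveDef; first exact: diff_derivable.
by rewrite [LHS](deriveE _ dFg) diff_comp//= -(deriveE _ dgt) dgE -deriveE.
Qed.

Lemma is_derive_row3 (V : normedModType R) (x v : V) (M : V -> 'rV[R]_3) dM :
  is_derive x v (fun w => cx (M w)) (cx dM) ->
  is_derive x v (fun w => cy (M w)) (cy dM) ->
  is_derive x v (fun w => cz (M w)) (cz dM) ->
  is_derive x v M dM.
Proof.
move=> hx hy hz.
have h j : is_derive x v (fun w => M w 0 j) (dM 0 j).
  case: j => -[|[|[|//]]] hi.
  - by move: hx; rewrite /cx; congr is_derive; [apply/funext => w|];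
      congr (_ _ _); apply: val_inj.
  - by move: hy; rewrite /cy; congr is_derive; [apply/funext => w|];
      congr (_ _ _); apply: val_inj.
  - by move: hz; rewrite /cz; congr is_derive; [apply/funext => w|];
      congr (_ _ _); apply: val_inj.
have dm : derivable M x v.
  by apply/derivable_mxP => i j; rewrite (ord1 i); case: (h j).
apply: DeriveDef => //; rewrite derive_mx//; apply/rowP => j.
by rewrite mxE; case: (h j).
Qed.

Lemma is_derive_curve_coord (g : R -> 'rV[R]_3) (t : R) (dg : 'rV[R]_3) : is_derive t 1 g dg ->
  [/\ is_derive t 1 (fun s => cx (g s)) (cx dg),
      is_derive t 1 (fun s => cy (g s)) (cy dg) &
      is_derive t 1 (fun s => cz (g s)) (cz dg)].
Proof.
move=> hg.
have h i : is_derive t 1 (fun s => g s 0 i) (dg 0 i).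
  have [_ <-] := is_derive_coord i (g t) dg.
  exact: (is_derive_along (F := fun w : 'rV[R]_3 => w 0 i)
    (differentiable_coord _ _ _) hg).
by split; exact: h.
Qed.

Lemma is_derive_dot (g h : R -> 'rV[R]_3) (t : R) (dg dh : 'rV[R]_3) :
  is_derive t 1 g dg -> is_derive t 1 h dh ->
  is_derive t 1 (fun s => dot (g s) (h s)) (dot dg (h t) + dot (g t) dh).
Proof.
move=> /is_derive_curve_coord[gx gy gz] /is_derive_curve_coord[hx hy hz].
have -> : (fun s => dot (g s) (h s)) = (fun s => cx (g s) * cx (h s))
    + (fun s => cy (g s) * cy (h s)) + (fun s => cz (g s) * cz (h s)).
  by apply/funext => s; rewrite dotE.
apply: is_derive_eq.
by rewrite !dotE /GRing.scale /=; ring.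
Qed.

(** As [u] is orthogonal to [p], the squared norm of p + t u is 1 + t^2 |u|^2, without a first-order
    term. The normalising factor is thus stationary at 0 and the projected curve keeps the velocity
    [u]. *)
Lemma is_derive_radial (p : S2 R) u : tangent p u ->
  is_derive (0 : R) 1 (fun t : R => val (radial (val p + t *: u))) u.
Proof.
rewrite /tangent => pu; set s := fun t : R => (Num.sqrt (1 + t ^+ 2 * dot u u))^-1.
have E t : dot (val p + t *: u) (val p + t *: u) = 1 + t ^+ 2 * dot u u.
  by rewrite dotDl !dotDr !dotZl !dotZr dot_S2 (dotC u) pu; ring.
have P t : 0 < 1 + t ^+ 2 * dot u u.
  by rewrite ltr_pwDl// mulr_ge0 ?sqr_ge0 ?dot_ge0.
have -> : (fun t : R => val (radial (val p + t *: u)))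
    = (fun t => s t *: (val p + t *: u)).
  by apply/funext => t; rewrite val_radial ?E.
have ds : is_derive (0 : R) 1 s 0.
  pose N (t : R) : R := 1 + t ^+ 2 * dot u u.
  have d1 : is_derive (0 : R) 1 N 0.
    rewrite /N; apply: is_derive_eq.
    by rewrite /GRing.scale /=; ring.
  have d2 : is_derive (0 : R) 1 (Num.sqrt \o N) 0.
    rewrite -[0 in X in is_derive _ _ _ X](mulr0 (2 * Num.sqrt (N 0))^-1).
    exact: (@is_derive1_comp _ _ N _ _ _ (is_derive1_sqrt (P 0)) d1).
  have nz : (Num.sqrt \o N) 0 != 0.
    by rewrite /= gt_eqF// sqrtr_gt0 P.
  apply: DeriveDef; first by apply: (derivableV nz); case: d2.
  rewrite (deriveV nz); last by case: d2.
  by rewrite (@derive_val _ _ _ _ _ _ _ d2) scaler0.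
have s0 : s 0 = 1 by rewrite /s expr0n mul0r addr0 sqrtr1 invr1.
have lin (a b : R) : is_derive (0 : R) 1 (fun t : R => s t * (a + t * b)) b.
  apply: is_derive_eq.
  by rewrite s0 /GRing.scale /=; ring.
apply: is_derive_row3; rewrite /=.
- by under eq_fun do rewrite !coordE; exact: lin.
- by under eq_fun do rewrite !coordE; exact: lin.
- by under eq_fun do rewrite !coordE; exact: lin.
Qed.

Lemma radial_S2 (p : S2 R) : radial (val p) = p.
Proof.
by apply: val_inj; rewrite val_radial dot_S2// sqrtr1 invr1 scale1r.
Qed.

(** The chain rule along the radial curve: any ambient extension computes the intrinsic differential
    on tangent vectors. *)
Lemma S2_diffE (W : normedModType R) (f : S2 R -> W) (F : 'rV[R]_3 -> W) p u :
  (forall q, f q = F (val q)) -> differentiable F (val p) -> tangent p u ->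
  S2_diff f p u = 'D_u F (val p).
Proof.
move=> fF dF pu; rewrite /S2_diff derive1E.
have -> : (fun t : R => f (radial (val p + t *: u)))
    = (fun t => F (val (radial (val p + t *: u)))).
  by apply/funext => t; rewrite fF.
have r0 : val (radial (val p + (0 : R) *: u)) = val p.
  by rewrite scale0r addr0 radial_S2.
rewrite -{2}r0; apply: derive_val.
by apply: is_derive_along; [rewrite r0|exact: is_derive_radial].
Qed.

(** Gram-Schmidt: [r] is the normalised part of [q] orthogonal to [p], and T is the angle between
    the two points. *)
Lemma great_circle (p q : S2 R) : exists (T : R) (r : 'rV[R]_3),
  [/\ dot (val p) r = 0, dot r r = 1 & val q = cos T *: val p + sin T *: r].
Proof.
set c := dot (val p) (val q).
have E : dot (val q - c *: val p) (val q - c *: val p) = 1 - c ^+ 2.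
  by rewrite -scaleNr dotDl !dotDr !dotZl !dotZr !dot_S2 (dotC (val q)) -/c; ring.
have c1 : 0 <= 1 - c ^+ 2 by rewrite -E dot_ge0.
(* Equality in Cauchy-Schwarz: [q] is [p] or its antipode, and any unit vector orthogonal to [p]
   serves as [r]. *)
have [c0|cn0] := eqVneq (1 - c ^+ 2) 0.
  have qE : val q = c *: val p.
    by apply/eqP; rewrite -subr_eq0; apply/eqP/dot_eq0; rewrite E.
  have [T [cT sT]] : exists t : R, cos t = c /\ sin t = 0.
    by apply: exists_angle; rewrite expr0n addr0; lra.
  suff [r [r1 r2]] : exists r, dot (val p) r = 0 /\ dot r r = 1.
    by exists T, r; split=> //; rewrite cT sT scale0r addr0.
  have hp := dot_S2 p; rewrite dotE in hp.
  set x := cx (val p) in hp *; set y := cy (val p) in hp *.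
  set d := x ^+ 2 + y ^+ 2.
  have d0 : 0 <= d by rewrite addr_ge0 ?sqr_ge0.
  (* At a pole the first basis vector is orthogonal to [p]; elsewhere the horizontal vector (-y, x,
     0) is, once normalised. *)
  have [d00|dn0] := eqVneq d 0.
    exists (row3 1 0 0); rewrite !dotE !coordE -/x -/y; split; last by ring.
    have x2 : x ^+ 2 = 0 by have := sqr_ge0 x; have := sqr_ge0 y; move: d00; rewrite /d; lra.
    by move/eqP: x2; rewrite sqrf_eq0 => /eqP ->; ring.
  have sd : Num.sqrt d != 0 by rewrite sqrtr_eq0 -ltNge lt_def dn0.
  exists (row3 (- y / Num.sqrt d) (x / Num.sqrt d) 0).
  rewrite !dotE !coordE -/x -/y; split; first by field.
  have e2 : Num.sqrt d ^+ 2 = d by rewrite sqr_sqrtr.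
  set e := Num.sqrt d in sd e2 *.
  transitivity (d / e ^+ 2); first by rewrite /d; field.
  by rewrite e2 divff.
set s := Num.sqrt (1 - c ^+ 2).
have s2 : s ^+ 2 = 1 - c ^+ 2 by rewrite sqr_sqrtr.
have s0 : s != 0 by rewrite sqrtr_eq0 -ltNge lt_def cn0.
have [T [cT sT]] : exists t : R, cos t = c /\ sin t = s.
  by apply: exists_angle; rewrite s2; ring.
exists T, (s^-1 *: (val q - c *: val p)); split.
- by rewrite dotZr dotDr dotNr dotZr dot_S2 -/c; ring.
- by rewrite dotZl dotZr E -s2; field.
- by rewrite cT sT scalerA divff// scale1r addrC subrK.
Qed.

Section GreatCircle.
Variables (p : S2 R) (r : 'rV[R]_3).
Hypotheses (pr : dot (val p) r = 0) (rr : dot r r = 1).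

Definition circle (t : R) : 'rV[R]_3 := cos t *: val p + sin t *: r.
Definition circle' (t : R) : 'rV[R]_3 := - sin t *: val p + cos t *: r.

Lemma dot_circle t : dot (circle t) (circle t) = 1.
Proof.
have c2 := cos2Dsin2 t.
by rewrite dotDl !dotDr !dotZl !dotZr dot_S2 (dotC r) pr rr -[RHS]c2; ring.
Qed.

Definition circle_pt t : S2 R := mkS2 (dot_circle t).

Lemma tangent_circle t : tangent (circle_pt t) (circle' t).
Proof.
rewrite /tangent val_mkS2 dotDl !dotDr !dotZl !dotZr dot_S2 (dotC r) pr rr; ring.
Qed.

Lemma is_derive_circle (t : R) : is_derive t 1 circle (circle' t).
Proof.
by apply: is_derive_row3; under eq_fun do rewrite !coordE;
  apply: is_derive_eq; rewrite !coordE /GRing.scale /=; ring.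
Qed.

Lemma is_derive_circle' (t : R) : is_derive t 1 circle' (- circle t).
Proof.
by apply: is_derive_row3; under eq_fun do rewrite !coordE;
  apply: is_derive_eq; rewrite !coordE /GRing.scale /=; ring.
Qed.

End GreatCircle.

Lemma smooth_differentiable (V W : normedModType R) (F : V -> W) x :
  smooth F -> differentiable F x.
Proof. by move=> /(_ 1%N)[]. Qed.

(** Any two points lie on a great circle, along which [f] has zero derivative. *)
Lemma S2_diff0_const (f : S2 R -> R) (F : 'rV[R]_3 -> R) :
  (forall x, differentiable F x) -> (forall p, f p = F (val p)) ->
  (forall p u, tangent p u -> S2_diff f p u = 0) -> forall p q, f p = f q.
Proof.
move=> dF fF df p q; have [T [r [pr rr qE]]] := great_circle p q.
have h (t : R) : is_derive t 1 (fun s => F (circle p r s)) 0.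
  have t0 := tangent_circle pr rr t.
  rewrite -(df _ _ t0) (S2_diffE fF _ t0) ?val_mkS2//.
  exact: is_derive_along (dF _) (is_derive_circle p r t).
have := is_derive_0_is_cst 0 T h.
by rewrite /circle -qE cos0 sin0 scale1r scale0r addr0 -!fF.
Qed.

End Calculus.

(** * Killing fields of the sphere as infinitesimal rotations *)

Section KillingFields.
Context {R : realType}.
Variable n : nat.
Hypothesis n_gt0 : (0 < n)%N.

(** The normal correction in [nabla] is invisible to tangent vectors, so the Killing equation can be
    tested on the ambient derivative. *)
Lemma nabla_dot (X : S2 R -> 'rV[R]_3) p u v : tangent p v ->
  dot (nabla X p u) v = dot (S2_diff X p u) v.
Proof. by rewrite /tangent /nabla -scaleNr dotDl dotZl => ->; ring. Qed.

(* Along a great circle the component of a Killing field on the velocity is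
   constant. *)
Lemma killing_skew (X : S2 R -> 'rV[R]_3) : killing n X ->
  forall p q, dot (X p) (val q) + dot (X q) (val p) = 0.
Proof.
move=> [tX [F [sF XF]] kX] p q; have [T [r [pr rr qE]]] := great_circle p q.
have n0 : n%:R != 0 :> R by rewrite pnatr_eq0 -lt0n.
have h (t : R) : is_derive t 1 (fun s => dot (F (circle p r s)) (circle' p r s)) 0.
  have dF := smooth_differentiable (circle p r t) sF.
  have t0 := tangent_circle pr rr t.
  have dX := S2_diffE (p := circle_pt pr rr t) XF dF t0; rewrite val_mkS2 in dX.
  have hd := is_derive_dot (is_derive_along dF (is_derive_circle p r t))
    (is_derive_circle' p r t).
  (* The first term is half of the Killing equation taken at twice the velocity; the second vanishes
     because the acceleration of a great circle is normal and [X] is tangent. *)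
  suff E0 : dot ('D_(circle' p r t) F (circle p r t)) (circle' p r t)
      + dot (F (circle p r t)) (- circle p r t) = 0 by rewrite E0 in hd.
  have := kX _ _ _ t0 t0.
  rewrite /metric [dot (circle' p r t) _]dotC nabla_dot// dX.
  move=> /eqP; rewrite -mulrDr mulf_eq0 (negPf n0)/=.
  rewrite -mulr2n mulrn_eq0/= => /eqP ->.
  by rewrite dotNr -[circle p r t](val_mkS2 (dot_circle pr rr t)) -XF dotC tX; ring.
have := is_derive_0_is_cst 0 T h.
rewrite /circle -qE cos0 sin0 scale1r scale0r addr0 -!XF.
rewrite /circle' cos0 sin0 oppr0 scale0r scale1r add0r.
have e1 : dot (X p) (val q) = sin T * dot (X p) r.
  by rewrite qE dotDr !dotZr dotC tX; ring.
(* Multiplying the equality of the two end values by sin T, rather than dividing, covers antipodal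
   and equal points too. The term along [q] then vanishes by tangency of [X q]. *)
have e2 : sin T *: (- sin T *: val p + cos T *: r) = cos T *: val q - val p.
  have c2 := sin2cos2 T; rewrite qE.
  apply: row3P; rewrite !coordE; ring: c2.
rewrite e1 => ->; rewrite -dotZr e2 dotDr dotZr dotNr dotC tX; ring.
Qed.

Lemma e1_subproof : dot (row3 1 0 0) (row3 1 0 0) = 1 :> R.
Proof. by rewrite dotE !coordE; ring. Qed.
Lemma e2_subproof : dot (row3 0 1 0) (row3 0 1 0) = 1 :> R.
Proof. by rewrite dotE !coordE; ring. Qed.

(** Pairing [X p] with a basis vector e gives minus the pairing of [X e] with [p], so [X] is
    determined by its values on the basis; these form a skew matrix. *)
Lemma killing_rotation (X : S2 R -> 'rV[R]_3) : killing n X ->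
  exists w, forall p, X p = cross w (val p).
Proof.
move=> kX; have sk := killing_skew kX.
pose e1 := mkS2 e1_subproof; pose e2 := mkS2 e2_subproof; pose e3 : S2 R := north.
(* The entries of the axis are read off the skew matrix of w -> w x e_i on the three basis
   vectors. *)
exists (row3 (cz (X e2)) (cx (X e3)) (cy (X e1))) => p.
have s11 := sk e1 e1; have s22 := sk e2 e2; have s33 := sk e3 e3.
have s12 := sk e1 e2; have s13 := sk e1 e3; have s23 := sk e2 e3.
have sp1 := sk p e1; have sp2 := sk p e2; have sp3 := sk p e3.
rewrite /north !val_mkS2 !dotE !coordE in s11 s22 s33 s12 s13 s23 sp1 sp2 sp3.
have x11 : cx (X e1) = 0 by lra.
have x22 : cy (X e2) = 0 by lra.
have x33 : cz (X e3) = 0 by lra.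
have x12 : cx (X e2) = - cy (X e1) by lra.
have x13 : cz (X e1) = - cx (X e3) by lra.
have x23 : cy (X e3) = - cz (X e2) by lra.
rewrite x11 x13 in sp1; rewrite x12 x22 in sp2; rewrite x33 x23 in sp3.
by apply: row3P; rewrite !coordE; nra.
Qed.

End KillingFields.

(** * Smoothness and differentials of affine maps *)

Section Smoothness.
Context {R : realType}.

Lemma Cn_cst (V W : normedModType R) (a : W) k : Cn k (fun _ : V => a).
Proof.
elim: k a => [|k IH] a /=; first by move=> x; exact: cvg_cst.
split=> [x|v]; first exact: differentiable_cst.
suff -> : 'D_v (fun _ : V => a) = (fun _ => 0) by exact: IH.
by apply/funext => x; exact: derive_cst.
Qed.

Section Affine.
Variables (W : normedModType R) (F : 'rV[R]_3 -> W).
Hypothesis linF : linear F.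

(** In the standard basis, [F] is a finite sum of coordinate functions times fixed vectors. *)
Lemma linear_rV_differentiable x : differentiable F x.
Proof.
pose L : {linear 'rV[R]_3 -> W} :=
  HB.pack F (GRing.isLinear.Build R 'rV[R]_3 W *:%R F linF).
have -> : F = \sum_(j < 3) (fun v : 'rV[R]_3 => v 0 j *: F (delta_mx 0 j)).
  apply/funext => v; rewrite fct_sumE /= -[F]/(L : _ -> _) [in LHS](row_sum_delta v).
  by rewrite linear_sum; apply: eq_bigr => j _; rewrite linearZ.
apply: differentiable_sum => j; apply: differentiableZl.
exact: differentiable_coord.
Qed.

Lemma is_derive_affine (b : W) x v : is_derive x v (fun w => F w + b) (F v).
Proof.
pose L : {linear 'rV[R]_3 -> W} :=
  HB.pack F (GRing.isLinear.Build R 'rV[R]_3 W *:%R F linF).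
have cF : continuous L.
  by move=> y; apply/differentiable_continuous/linear_rV_differentiable.
have dF : is_derive x v F (F v).
  apply: DeriveDef; first exact/diff_derivable/linear_rV_differentiable.
  by rewrite deriveE; [rewrite (diff_lin x cF)|exact: linear_rV_differentiable].
by rewrite -[F v]addr0; apply: is_deriveD.
Qed.

Lemma derive_affine (b : W) v : 'D_v (fun w => F w + b) = fun _ => F v.
Proof.
by apply/funext => x; exact: (@derive_val _ _ _ _ _ _ _ (is_derive_affine b x v)).
Qed.

Lemma affine_differentiable (b : W) x : differentiable (fun w => F w + b) x.
Proof.
by apply: differentiableD; [exact: linear_rV_differentiable|exact: differentiable_cst].
Qed.

(** The first directional derivatives are constant, so all higher orders reduce to [Cn_cst]. *)
Lemma smooth_affine (b : W) : smooth (fun w => F w + b).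
Proof.
case=> [|k] /=.
  by move=> x; apply/differentiable_continuous/affine_differentiable.
split=> [|v]; first exact: affine_differentiable.
by rewrite derive_affine; exact: Cn_cst.
Qed.

Lemma smooth_linear : smooth F.
Proof.
have -> : F = (fun w => F w + 0) by apply/funext => w; rewrite addr0.
exact: smooth_affine.
Qed.

Lemma S2_diff_linear (f : S2 R -> W) (b : W) p u :
  (forall q, f q = F (val q) + b) -> tangent p u -> S2_diff f p u = F u.
Proof.
move=> fF pu; rewrite (S2_diffE (F := fun w => F w + b) fF _ pu).
  exact: (@derive_val _ _ _ _ _ _ _ (is_derive_affine b _ u)).
exact: affine_differentiable.
Qed.

End Affine.

Lemma dot_linear (A : 'rV[R]_3) : linear (dot A : 'rV[R]_3 -> R^o).
Proof. by move=> a u v; rewrite dotDr dotZr. Qed.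

End Smoothness.

(** * Kähler functions are exactly the affine functions *)

Section KahlerFunctions.
Context {R : realType}.
Variable n : nat.
Hypothesis n_gt0 : (0 < n)%N.

Lemma kahler_function_affine (f : S2 R -> R) : kahler_function n f ->
  exists A d, forall p, f p = dot A (val p) + d.
Proof.
move=> [[F [sF fF]] [X [[_ hX] kX]]]; have [w Xw] := killing_rotation n_gt0 kX.
(* The additive constant is the value at the north pole of f + n <w, .>, which is shown to be
   constant. *)
exists (- n%:R *: w), (f north + n%:R * dot w (val (north : S2 R))) => p.
pose L := dot (n%:R *: w) : 'rV[R]_3 -> R^o.
have dL x : differentiable L x by exact/linear_rV_differentiable/dot_linear.
have dF x : differentiable F x by exact: smooth_differentiable.
pose g q := f q + L (val q).
have gE q : g q = (F \+ L) (val q) by rewrite /g fF.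
have dg x : differentiable (F \+ L) x by exact: differentiableD.
suff : g p = g north.
  by rewrite /g /L !dotZl => <-; ring.
apply: (S2_diff0_const dg gE) => q u qu.
rewrite (S2_diffE gE (dg _) qu) deriveD; [|exact: diff_derivable..].
rewrite -(S2_diffE fF (dF _) qu) -(S2_diffE (f := fun q => L (val q)) _ (dL _) qu)//.
rewrite (S2_diff_linear (dot_linear (n%:R *: w)) (b := 0) _ qu); last first.
  by move=> ?; rewrite addr0.
rewrite -hX// /kform /metric /J Xw.
have q1 := dot_S2 q; rewrite dotE in q1; rewrite /tangent dotE in qu.
(* Triple product: (w x q) x q = <w, q> q - w, and the first term dies against the tangent vector
   [u]. *)
suff -> : dot (cross (cross w (val q)) (val q)) u = - dot w u by rewrite dotZl; ring.
rewrite !dotE !coordE.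
set x := cx (val q) in q1 qu *; set y := cy (val q) in q1 qu *.
set z := cz (val q) in q1 qu *.
transitivity ((x * cx w + y * cy w + z * cz w) * (x * cx u + y * cy u + z * cz u)
  - (x * x + y * y + z * z) * (cx w * cx u + cy w * cy u + cz w * cz u)); first by ring.
by rewrite q1 qu; ring.
Qed.

Lemma cross_linear (A : 'rV[R]_3) (k : R) :
  linear (fun v : 'rV[R]_3 => k *: cross v A).
Proof. by move=> a u v; apply: row3P; rewrite !coordE; ring. Qed.

Lemma affine_kahler_function (A : 'rV[R]_3) (d : R) :
  kahler_function n (fun p : S2 R => dot A (val p) + d).
Proof.
have n0 : n%:R != 0 :> R by rewrite pnatr_eq0 -lt0n.
split; first by exists (fun v => dot A v + d); split=> //; exact: (smooth_affine (dot_linear A)).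
(* Solving J X = grad f: since (p x A) x p = A - <A, p> p is the tangential part of [A], the factor
   1/n cancels the one in the metric. *)
pose X (p : S2 R) := n%:R^-1 *: cross (val p) A; exists X.
have tX : vector_field X.
  by move=> p; rewrite /tangent dotE !coordE; ring.
have lX := cross_linear A n%:R^-1.
have sX : S2_smooth X.
  by exists (fun v => n%:R^-1 *: cross v A); split=> //; exact: smooth_linear.
have dX p u : tangent p u -> S2_diff X p u = n%:R^-1 *: cross u A.
  by move=> pu; apply: (S2_diff_linear lX (b := 0)) => // q; rewrite addr0.
split; last first.
  split; [exact: tX|exact: sX|move=> p u v pu pv].
  (* The field is linear with ambient derivative (1/n) u x A, and <u x A, v> is skew in [u] and
     [v]. *)
  have e1 := nabla_dot X u pv; rewrite (dX _ _ pu) in e1.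
  have e2 := nabla_dot X v pu; rewrite (dX _ _ pv) dotC in e2.
  rewrite /metric e1 e2.
  by rewrite !dotE !coordE; field.
split; [exact: tX|move=> p u pu].
  rewrite (S2_diff_linear (dot_linear A) (b := d) _ pu)//.
  rewrite /kform /metric /J /X; have q1 := dot_S2 p.
  move: pu; rewrite /tangent !dotE !coordE in q1 *.
  set x := cx (val p) in q1 *; set y := cy (val p) in q1 *.
  set z := cz (val p) in q1 * => pu.
  transitivity ((x * x + y * y + z * z) * (cx A * cx u + cy A * cy u + cz A * cz u)
    - (x * cx A + y * cy A + z * cz A) * (x * cx u + y * cy u + z * cz u)).
    by field.
  by rewrite q1 pu; ring.
Qed.

End KahlerFunctions.

(** * Rotations and the identity component of the holomorphic isometries *)

Section Rotations.
Context {R : realType}.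

Section Continuity.
Variable T : topologicalType.

Lemma continuous_row3 (a b c : T -> R) : continuous a -> continuous b ->
  continuous c -> continuous (fun z => row3 (a z) (b z) (c z)).
Proof.
move=> ca cb cc.
have E x y z : row3 x y z =
    x *: row3 1 0 0 + y *: row3 0 1 0 + z *: row3 0 0 1 :> 'rV[R]_3.
  by apply: row3P; rewrite !coordE; ring.
have -> : (fun z => row3 (a z) (b z) (c z)) = (fun z =>
    a z *: row3 1 0 0 + b z *: row3 0 1 0 + c z *: row3 0 0 1).
  by apply/funext => z; rewrite E.
move=> z; apply: cvgD; first apply: cvgD.
- by apply: cvgZr_tmp; exact: ca.
- by apply: cvgZr_tmp; exact: cb.
- by apply: cvgZr_tmp; exact: cc.
Qed.

Lemma continuous_S2 (f : T -> S2 R) : continuous (fun z => val (f z)) ->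
  continuous f.
Proof. by move=> cf; apply: continuous_comp_initial. Qed.

Variables (t : T -> R) (v : T -> 'rV[R]_3).
Hypotheses (ct : continuous t) (cv : continuous v).

Lemma continuous_entry i : continuous (fun z => v z 0 i).
Proof.
move=> z; apply: (@continuous_comp _ _ _ v (fun w : 'rV[R]_3 => w 0 i)).
  exact: cv.
exact: coord_continuous.
Qed.

Lemma continuous_cos_comp : continuous (fun z => cos (t z)).
Proof.
by move=> z; apply: (@continuous_comp _ _ _ t (@cos R)); [exact: ct|exact: continuous_cos].
Qed.

Lemma continuous_sin_comp : continuous (fun z => sin (t z)).
Proof.
by move=> z; apply: (@continuous_comp _ _ _ t (@sin R)); [exact: ct|exact: continuous_sin].
Qed.

Lemma continuous_rotz : continuous (fun z => rotz (t z) (v z)).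
Proof.
have cc := continuous_cos_comp; have cs := continuous_sin_comp.
have ce := continuous_entry.
apply: continuous_row3 => z.
- by apply: cvgB; apply: cvgM; [exact: cc|exact: ce|exact: cs|exact: ce].
- by apply: cvgD; apply: cvgM; [exact: cs|exact: ce|exact: cc|exact: ce].
- exact: ce.
Qed.

Definition roty (s : R) (u : 'rV[R]_3) : 'rV[R]_3 :=
  row3 (cos s * cx u + sin s * cz u) (cy u) (cos s * cz u - sin s * cx u).

Lemma continuous_roty : continuous (fun z => roty (t z) (v z)).
Proof.
have cc := continuous_cos_comp; have cs := continuous_sin_comp.
have ce := continuous_entry.
apply: continuous_row3 => z.
- by apply: cvgD; apply: cvgM; [exact: cc|exact: ce|exact: cs|exact: ce].
- exact: ce.
- by apply: cvgB; apply: cvgM; [exact: cc|exact: ce|exact: cs|exact: ce].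
Qed.

End Continuity.

(** A form of SO(3): preserving the dot product is orthogonality, and preserving the cross product
    fixes the orientation. The latter is what commuting with [J] requires, [J] being a cross
    product. *)
Definition rotation (L : 'rV[R]_3 -> 'rV[R]_3) : Prop :=
  [/\ linear L, forall u v, dot (L u) (L v) = dot u v &
      forall u v, L (cross u v) = cross (L u) (L v)].

Lemma rotation_comp (L M : 'rV[R]_3 -> 'rV[R]_3) :
  rotation L -> rotation M -> rotation (L \o M).
Proof.
move=> [lL dL cL] [lM dM cM]; split=> [a u v|u v|u v] /=.
- by rewrite lM lL.
- by rewrite dL dM.
- by rewrite cM cL.
Qed.

Lemma rotation_rotz (s : R) : rotation (rotz s).
Proof.
have c2 := sin2cos2 s; split=> [a u v|u v|u v].
- by apply: row3P; rewrite !coordE; ring.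
- by rewrite !dotE !coordE; ring: c2.
- by apply: row3P; rewrite !coordE; ring: c2.
Qed.

Lemma rotation_roty (s : R) : rotation (roty s).
Proof.
have c2 := sin2cos2 s; split=> [a u v|u v|u v].
- by apply: row3P; rewrite !coordE; ring.
- by rewrite !dotE !coordE; ring: c2.
- by apply: row3P; rewrite !coordE; ring: c2.
Qed.

Lemma rotzK (s : R) : cancel (rotz s) (rotz (- s)).
Proof.
have c2 := sin2cos2 s; move=> u.
by apply: row3P; rewrite !coordE ?cosN ?sinN; ring: c2.
Qed.

Lemma rotyK (s : R) : cancel (roty s) (roty (- s)).
Proof.
have c2 := sin2cos2 s; move=> u.
by apply: row3P; rewrite !coordE ?cosN ?sinN; ring: c2.
Qed.

(** The differential of the restriction of a linear map is that map, so both conditions on tangent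
    vectors are the algebraic identities in [rotation]. *)
Lemma rotation_holomorphic_isometry (n : nat) (L M : 'rV[R]_3 -> 'rV[R]_3)
    (phi psi : S2 R -> S2 R) :
  rotation L -> rotation M -> cancel L M -> cancel M L ->
  (forall p, val (phi p) = L (val p)) -> (forall p, val (psi p) = M (val p)) ->
  holomorphic_isometry n phi.
Proof.
move=> [lL dL cL] [lM _ _] LK MK phiE psiE.
have dphi p u : tangent p u -> S2_dmap phi p u = L u.
  move=> pu; apply: (S2_diff_linear lL (b := 0)) => // q.
  by rewrite addr0; exact: phiE.
split.
- by exists L; split=> //; exact: smooth_linear.
- exists psi; split.
  + by exists M; split=> //; exact: smooth_linear.
  + by move=> p; apply: val_inj; rewrite [LHS]psiE phiE LK.
  + by move=> p; apply: val_inj; rewrite [LHS]phiE psiE MK.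
- by move=> p u v pu pv; rewrite /metric (dphi _ _ pu) (dphi _ _ pv) dL.
- move=> p u pu; rewrite (dphi _ _ pu) (dphi p (J p u)).
    by rewrite /J cL phiE.
  by rewrite /tangent /J dotE !coordE; ring.
Qed.

(** Two of the three Euler angles are enough to carry any unit vector to the north pole. *)
Definition euler (a b : R) : 'rV[R]_3 -> 'rV[R]_3 := roty b \o rotz a.

Lemma rotation_euler a b : rotation (euler a b).
Proof. by apply: rotation_comp; [exact: rotation_roty|exact: rotation_rotz]. Qed.

Lemma euler_subproof a b (p : S2 R) : dot (euler a b (val p)) (euler a b (val p)) = 1.
Proof. by have [_ -> _] := rotation_euler a b; exact: dot_S2. Qed.

Definition euler_S2 a b (p : S2 R) : S2 R := mkS2 (euler_subproof a b p).

Lemma euler_holomorphic_isometry (n : nat) a b :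
  holomorphic_isometry n (euler_S2 a b).
Proof.
have dM (p : S2 R) : dot ((rotz (- a) \o roty (- b)) (val p)) ((rotz (- a) \o roty (- b)) (val p))
    = 1 :> R.
  by rewrite /=; have [_ -> _] := rotation_rotz (- a); have [_ -> _] := rotation_roty (- b);
    exact: dot_S2.
apply: (@rotation_holomorphic_isometry n (euler a b) (rotz (- a) \o roty (- b)) _
  (fun p => mkS2 (dM p))) => //.
- exact: rotation_euler.
- by apply: rotation_comp; [exact: rotation_rotz|exact: rotation_roty].
- by move=> u; rewrite /euler /= rotyK rotzK.
- by move=> u; rewrite /euler /= -[in rotz a](opprK a) rotzK -[in roty b](opprK b) rotyK.
Qed.

Lemma euler0 : euler_S2 0 0 = id.
Proof.
apply/funext => p; apply: val_inj; apply: row3P;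
  by rewrite /= !coordE ?cos0 ?sin0; ring.
Qed.

(** Scaling both angles by s gives a path of holomorphic isometries from the identity at s = 0 to
    the given one at s = 1. *)
Lemma euler_identity_component (n : nat) a b : identity_component n (euler_S2 a b).
Proof.
pose f (z : R * S2 R) : S2 R := euler_S2 (z.1 * a) (z.1 * b) z.2.
have cf : continuous f.
  have c1 k : continuous (fun z : R * S2 R => z.1 * k).
    by move=> z; apply: cvgM; [exact: cvg_fst|exact: cvg_cst].
  apply: continuous_S2; apply: continuous_roty; first exact: c1.
  apply: continuous_rotz; first exact: c1.
  move=> z; apply: (@continuous_comp _ _ _ snd (fun p : S2 R => val p)).
    exact: cvg_snd.
  exact: initial_continuous.
(* Joint continuity in the parameter and the point yields, by currying, continuity into the
   compact-open topology. *)
have [cc _] := continuous_curry cf.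
have fE s : curry f s = euler_S2 (s * a) (s * b) by [].
pose B : set {compact-open, S2 R -> S2 R} := curry f @` [set: R].
suff : B `<=` connected_component
    (holomorphic_isometry n : set {compact-open, S2 R -> S2 R}) id.
  by apply; exists 1 => //; rewrite fE !mul1r.
apply: connected_component_max.
- by exists 0 => //; rewrite fE !mul0r euler0.
- by move=> _ [s _ <-]; exact: (euler_holomorphic_isometry n (s * a) (s * b)).
- apply: connected_continuous_connected; last exact: continuous_subspaceT.
  by apply/connected_intervalP => x y _ _ z.
Qed.

(** A turn about the z axis takes [A] to (s, 0, z), and a turn about the y axis takes that to the
    pole. The height after the rotation is then the component along [A]. *)
Lemma exists_euler (A : 'rV[R]_3) : dot A A = 1 ->
  exists a b, forall p : S2 R, cz (val (euler_S2 a b p)) = dot A (val p).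
Proof.
rewrite dotE; set x := cx A; set y := cy A; set z := cz A => h.
set s := Num.sqrt (x ^+ 2 + y ^+ 2).
have s2 : s ^+ 2 = x ^+ 2 + y ^+ 2 by rewrite sqr_sqrtr// addr_ge0 ?sqr_ge0.
have [b [cb sb]] : exists t : R, cos t = z /\ sin t = - s.
  by apply: exists_angle; rewrite sqrrN s2; lra.
suff [a [ca sa]] : exists t : R, s * cos t = x /\ s * sin t = - y.
  exists a, b => p; rewrite /= !coordE cb sb dotE -/x -/y -/z.
  have yE : y = - (s * sin a) by rewrite sa opprK.
  by rewrite -ca yE; ring.
(* Here [A] is already on the z axis and the first angle is arbitrary. *)
have [s0|sn0] := eqVneq s 0.
  have x2 := sqr_ge0 x; have y2 := sqr_ge0 y; rewrite s0 expr0n /= in s2.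
  exists 0; rewrite s0 !mul0r; split; apply/esym/eqP; rewrite ?oppr_eq0 -sqrf_eq0; apply/eqP; lra.
have [a [ca sa]] : exists t : R, cos t = x / s /\ sin t = - y / s.
  apply: exists_angle; rewrite !exprMn sqrrN exprVn s2 -mulrDl divff//.
  by rewrite -s2 sqrf_eq0.
by exists a; rewrite ca sa; split; field.
Qed.

End Rotations.

(** * Moments and Fisher information of the binomial family *)

Section BinomialMoments.
Context {R : realType}.
Implicit Types q : R.

Lemma sum_binomial_pmf n q : \sum_(k < n.+1) binomial_pmf n q k = 1.
Proof.
transitivity (((1 - q) + q) ^+ n); last by rewrite subrK expr1n.
by rewrite exprDn; apply: eq_bigr => k _; rewrite /binomial_pmf mulrC.
Qed.

(** Absorption k C(n, k) = n C(n-1, k-1). Leaving the weight [g] free gives the mean for g = 1 and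
    the second moment for g k = k. *)
Lemma sum_binomial_pmf_shift n q (g : nat -> R) :
  \sum_(k < n.+2) k%:R * g k * binomial_pmf n.+1 q k =
  n.+1%:R * q * \sum_(k < n.+1) g k.+1 * binomial_pmf n q k.
Proof.
rewrite big_ord_recl /= !mul0r add0r mulr_sumr; apply: eq_bigr => k _.
rewrite /binomial_pmf /unstable.onem /bump /= add1n subSS exprS.
rewrite -[X in _ * X = _]mulr_natr -[X in _ = _ * (_ * X)]mulr_natr.
have E : n.+1%:R * 'C(n, k)%:R = k.+1%:R * 'C(n.+1, k.+1)%:R :> R.
  by rewrite -!natrM -mul_bin_diag.
transitivity (g k.+1 * q * q ^+ k * (1 - q) ^+ (n - k) * (k.+1%:R * 'C(n.+1, k.+1)%:R)).
  by ring.
by rewrite -E; ring.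
Qed.

Lemma binomial_mean n q :
  \sum_(k < n.+1) k%:R * binomial_pmf n q k = n%:R * q.
Proof.
case: n => [|n]; first by rewrite big_ord1 !mul0r.
have := sum_binomial_pmf_shift n q (fun _ => 1).
under eq_bigr do rewrite mulr1.
by move=> ->; under eq_bigr do rewrite mul1r; rewrite sum_binomial_pmf mulr1.
Qed.

Lemma binomial_moment2 n q :
  \sum_(k < n.+1) k%:R * k%:R * binomial_pmf n q k =
  n%:R * q * ((n%:R - 1) * q + 1).
Proof.
case: n => [|n]; first by rewrite big_ord1 !mul0r.
rewrite (sum_binomial_pmf_shift n q (fun k => k%:R)).
under eq_bigr do rewrite -natr1 mulrDl mul1r.
by rewrite big_split /= sum_binomial_pmf binomial_mean -natr1; ring.
Qed.

Lemma binomial_variance n q :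
  \sum_(k < n.+1) (k%:R - n%:R * q) ^+ 2 * binomial_pmf n q k =
  n%:R * q * (1 - q).
Proof.
transitivity (\sum_(k < n.+1) (k%:R * k%:R * binomial_pmf n q k
    + (- (2 * n%:R * q) * (k%:R * binomial_pmf n q k)
       + (n%:R * q) ^+ 2 * binomial_pmf n q k))).
  by apply: eq_bigr => k _; ring.
rewrite !big_split /= -!mulr_sumr sum_binomial_pmf binomial_mean binomial_moment2.
by ring.
Qed.

Lemma expectation_affine n q (p X : 'I_n.+1 -> R) a b :
  (forall k, p k = binomial_pmf n q k) -> (forall k, X k = a * Fstat k + b) ->
  Defs.expectation p X = a * (n%:R * q) + b.
Proof.
move=> pE XE; rewrite /Defs.expectation.
transitivity (\sum_(k < n.+1) (a * (k%:R * binomial_pmf n q k) + b * binomial_pmf n q k)).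
  by apply: eq_bigr => k _; rewrite pE XE /Fstat; ring.
by rewrite big_split /= -!mulr_sumr sum_binomial_pmf binomial_mean; ring.
Qed.

Definition logistic (s : R) : R := expR s / (1 + expR s).

Lemma logistic_itv s : 0 < logistic s < 1.
Proof.
have e0 := expR_gt0 s.
by rewrite divr_gt0 ?addr_gt0//= ltr_pdivrMr ?addr_gt0// mul1r; lra.
Qed.

Lemma logisticK q : 0 < q < 1 -> logistic (ln (q / (1 - q))) = q.
Proof.
move=> /andP[q0 q1]; have q1' : 0 < 1 - q by rewrite subr_gt0.
rewrite /logistic lnK ?posrE ?divr_gt0//.
by field; rewrite gt_eqF//=; lra.
Qed.

Lemma binomial_exp_logistic n s (k : 'I_n.+1) :
  binomial_exp s k = binomial_pmf n (logistic s) k.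
Proof.
have e0 := expR_gt0 s.
have E := binomial_expE k (logistic_itv s).
rewrite -E; congr (binomial_exp _ k).
rewrite -[LHS]expRK; congr ln; rewrite /logistic; field.
by rewrite !gt_eqF//; lra.
Qed.

(** The score, the derivative of the log-likelihood in the natural parameter, is k minus its mean,
    so the Fisher information is the variance. *)
Lemma fisher_binomial n s :
  fisher (@binomial_exp R n) s = n%:R * logistic s * (1 - logistic s).
Proof.
have e0 := expR_gt0 s; have e1 : 1 + expR s != 0 by rewrite gt_eqF//; lra.
rewrite -binomial_variance; apply: eq_bigr => k _.
rewrite binomial_exp_logistic; congr (_ ^+ 2 * _).
rewrite derive1E.
have -> : (fun s => ln (binomial_exp s k)) = (fun s : R =>
    ln 'C(n, k)%:R + s * Fstat k - n%:R * ln (1 + expR s)).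
  by apply/funext => u; rewrite expRK.
have dl : is_derive s 1 (fun s : R => ln (1 + expR s)) (logistic s).
  have d1 : is_derive s 1 (fun s : R => 1 + expR s) (expR s).
    by apply: is_derive_eq; rewrite /GRing.scale /=; ring.
  have d2 : is_derive (1 + expR s) 1 (@ln R) (1 + expR s)^-1.
    by apply: is_derive1_ln; rewrite addr_gt0.
  have := @is_derive1_comp _ _ (fun s : R => 1 + expR s) _ _ _ d2 d1.
  by rewrite mulrC.
apply: derive_val; apply: is_derive_eq.
by rewrite /Fstat /GRing.scale /=; ring.
Qed.

End BinomialMoments.

(** * Periods of the angle and the free locus of the torus action *)

Section Angles.
Context {R : realType}.

Lemma cos_sin_2pi_int (m : int) :
  cos (m%:~R * (2 * pi)) = 1 :> R /\ sin (m%:~R * (2 * pi)) = 0 :> R.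
Proof.
have h (k : nat) : cos (k%:R * (2 * pi)) = 1 :> R /\ sin (k%:R * (2 * pi)) = 0 :> R.
  have -> : k%:R * (2 * pi) = 0 + (pi *+ 2) *+ k :> R.
    by rewrite add0r -[X in _ = X *+ _]mulr_natl -[RHS]mulr_natl.
  rewrite (periodicn (@cosD2pi R)) (periodicn (@sinD2pi R)).
  by rewrite cos0 sin0.
case: m => k; first exact: h.
by rewrite NegzE mulrNz mulNr cosN sinN; have [-> ->] := h k.+1; rewrite oppr0.
Qed.

(** Reduce modulo 2 pi by a floor to y in [0, 2 pi). If y > 0 then sin (y/2) > 0, against cos y = 1
    - 2 sin^2 (y/2). *)
Lemma cos_eq1_2pi_int (x : R) : cos x = 1 -> exists m : int, x = m%:~R * (2 * pi).
Proof.
move=> cx1; have p0 := @pi_gt0 R; have p2 : 0 < 2 * pi :> R by rewrite mulr_gt0.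
pose m := Num.floor (x / (2 * pi)); exists m.
pose y := x - m%:~R * (2 * pi).
have [mc ms] := cos_sin_2pi_int m.
have cy1 : cos y = 1 by rewrite cosB mc ms cx1; ring.
have y0 : 0 <= y by rewrite subr_ge0 -ler_pdivlMr// floor_le.
have y1 : y < 2 * pi.
  rewrite ltrBlDr -[X in _ < X + _]mul1r -mulrDl -ltr_pdivrMr// addrC.
  by have := floorD1_gt (x / (2 * pi)); rewrite intrD.
suff : y = 0 by move=> /eqP; rewrite subr_eq0 => /eqP.
apply/eqP; rewrite eq_le y0 andbT leNgt; apply/negP => yp.
have s0 : 0 < sin (y / 2).
  by apply: sin_gt0_pi; rewrite divr_gt0//= ltr_pdivrMr// mulrC.
have : cos y = cos ((y / 2) *+ 2) by congr cos; rewrite -mulr_natr; field.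
rewrite cos_mulr2n cy1 cos2sin2 -[X in _ = X - _]mulr_natr => h.
have : sin (y / 2) ^+ 2 = 0 by lra.
by move/eqP; rewrite sqrf_eq0 gt_eqF.
Qed.

Lemma free_locusE (p : S2 R) :
  free_locus p <-> cx (val p) ^+ 2 + cy (val p) ^+ 2 != 0.
Proof.
set x := cx (val p); set y := cy (val p); split.
  move=> fp; apply/eqP => h.
  have x0 : x = 0.
    by apply/eqP; rewrite -sqrf_eq0; apply/eqP; have := sqr_ge0 x; have := sqr_ge0 y; lra.
  have y0 : y = 0.
    by apply/eqP; rewrite -sqrf_eq0; apply/eqP; have := sqr_ge0 x; have := sqr_ge0 y; lra.
  (* A half turn fixes a pole, whereas its parameter 1/2 is not an integer. *)
  have : torus_act 2^-1 p = p.
    by apply: val_inj; apply: row3P; rewrite /= ?coordE -/x -/y ?x0 ?y0; ring.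
  move=> /fp /intrP[m /eqP].
  rewrite -(mulr1 2^-1) eq_sym -(inj_eq (mulfI (_ : 2 != 0)))//.
  rewrite mulrA mulfV// mul1r.
  have -> : 2 * m%:~R = (2 * m)%:~R :> R by rewrite intrM.
  rewrite -[1]/(1%:~R) eqr_int => /eqP.
  by lia.
move=> h t /(congr1 (fun q => val q)) /= E.
have Ex := congr1 cx E; have Ey := congr1 cy E; rewrite !coordE -/x -/y in Ex Ey.
set c := cos _ in Ex Ey; set s := sin _ in Ex Ey.
have c1 : c = 1.
  (* Pairing the fixed-point equations with (x, y) eliminates the sine. *)
  apply/eqP; rewrite -subr_eq0; have /eqP : (c - 1) * (x ^+ 2 + y ^+ 2) = 0.
    transitivity ((c * x - s * y - x) * x + (s * x + c * y - y) * y); first by ring.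
    by rewrite Ex Ey; ring.
  by rewrite mulf_eq0 (negPf h) orbF.
have [m mE] := cos_eq1_2pi_int c1.
apply/intrP; exists m; apply: (mulfI (x := 2 * pi)).
  by rewrite mulf_neq0// gt_eqF// pi_gt0.
by rewrite mE mulrC.
Qed.

End Angles.

(** * Smoothness by closure under derivatives, and the profile functions of the torification *)

Section SmoothAlgebra.
Context {R : realType}.

(** Induction on the order: a class of differentiable functions that is stable under directional
    derivatives never leaves itself. *)
Lemma smooth_closed (V W : normedModType R) (C : (V -> W) -> Prop) :
  (forall f, C f -> (forall x, differentiable f x) /\ (forall v, C ('D_v f))) ->
  forall f, C f -> smooth f.
Proof.
move=> hC f Cf k; elim: k f Cf => [|k IH] f /hC [df Df] /=.
  by move=> x; exact/differentiable_continuous/df.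
by split=> // v; exact/IH/Df.
Qed.

Lemma differentiable_row3 (V : normedModType R) (f g h : V -> R) x :
  differentiable f x -> differentiable g x -> differentiable h x ->
  differentiable (fun w => row3 (f w) (g w) (h w)) x.
Proof.
move=> df dg dh.
have -> : (fun w => row3 (f w) (g w) (h w)) =
    (fun w => f w *: row3 1 0 0) + (fun w => g w *: row3 0 1 0)
    + (fun w => h w *: row3 0 0 1).
  by apply/funext => w; apply: row3P; rewrite !coordE; ring.
by apply: differentiableD; first apply: differentiableD; exact: differentiableZl.
Qed.

Lemma is_diff_fst_comp (h : R -> R) (u : R * R) (dh : R) :
  is_derive u.1 1 h dh -> differentiable (fun w : R * R => h w.1) u /\
  forall v : R * R, is_derive u v (fun w : R * R => h w.1) (v.1 * dh).
Proof.
move=> [dvh dhE]; have d1 : differentiable h u.1 by exact/derivable1_diffP.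
have df : differentiable (fst : R * R -> R) u.
  by apply: linear_differentiable => x; exact: cvg_fst.
have d2 : differentiable (h \o fst) u by exact: differentiable_comp.
split; first exact: d2.
move=> v; apply: DeriveDef; first by apply: diff_derivable; exact: d2.
rewrite [LHS](deriveE _ d2) diff_comp//= diff_lin; last by move=> x; exact: cvg_fst.
by rewrite diff1E// derive1E dhE.
Qed.

Lemma is_diff_snd_comp (h : R -> R) (u : R * R) (dh : R) :
  is_derive u.2 1 h dh -> differentiable (fun w : R * R => h w.2) u /\
  forall v : R * R, is_derive u v (fun w : R * R => h w.2) (v.2 * dh).
Proof.
move=> [dvh dhE]; have d1 : differentiable h u.2 by exact/derivable1_diffP.
have df : differentiable (snd : R * R -> R) u.
  by apply: linear_differentiable => x; exact: cvg_snd.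
have d2 : differentiable (h \o snd) u by exact: differentiable_comp.
split; first exact: d2.
move=> v; apply: DeriveDef; first by apply: diff_derivable; exact: d2.
rewrite [LHS](deriveE _ d2) diff_comp//= diff_lin; last by move=> x; exact: cvg_snd.
by rewrite diff1E// derive1E dhE.
Qed.

(** This is 1 / cosh (t/2), with the argument halved. It serves as the radius of the parallel of the
    sphere over the natural parameter [t]. *)
Definition sech (t : R) : R := 2 * expR (t / 2) / (1 + expR t).

Lemma sech_gt0 t : 0 < sech t.
Proof. by rewrite divr_gt0 ?mulr_gt0 ?addr_gt0 ?expR_gt0. Qed.

Lemma sech_sqr t : sech t ^+ 2 = 4 * logistic t * (1 - logistic t).
Proof.
have e0 := expR_gt0 t; have e1 : 1 + expR t != 0 by rewrite gt_eqF//; lra.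
have E : expR (t / 2) ^+ 2 = expR t.
  by rewrite -expRM_natr; congr expR; field.
rewrite /sech /logistic.
transitivity (4 * expR (t / 2) ^+ 2 / (1 + expR t) ^+ 2); first by field.
by rewrite E; field.
Qed.

(** The derivative is recorded as a polynomial in [logistic] itself, which keeps the functions below
    closed under differentiation. *)
Lemma is_derive_logistic (t : R) :
  is_derive t 1 logistic (logistic t * (1 - logistic t)).
Proof.
have e0 := expR_gt0 t; have e1 : 1 + expR t != 0 by rewrite gt_eqF//; lra.
have d1 : is_derive t 1 (fun s : R => 1 + expR s) (expR t).
  by apply: is_derive_eq; rewrite /GRing.scale /=; ring.
rewrite /logistic; apply: is_derive_eq; rewrite /GRing.scale /=; field.
exact: e1.
Qed.

Lemma is_derive_sech (t : R) :
  is_derive t 1 sech (2^-1 * sech t * (1 - 2 * logistic t)).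
Proof.
have e0 := expR_gt0 t; have e1 : 1 + expR t != 0 by rewrite gt_eqF//; lra.
have d1 : is_derive t 1 (fun s : R => 1 + expR s) (expR t).
  by apply: is_derive_eq; rewrite /GRing.scale /=; ring.
rewrite /sech; apply: is_derive_eq; rewrite /GRing.scale /= /logistic; field.
exact: e1.
Qed.

End SmoothAlgebra.

(** * The explicit torification of the binomial family by the sphere *)

Section Torification.
Context {R : realType}.

(* The algebra generated by the functions below is stable under directional
   derivatives. *)
Inductive tor_algebra : (R * R -> R) -> Prop :=
| tor_cst a : tor_algebra (fun _ => a)
| tor_add f g : tor_algebra f -> tor_algebra g -> tor_algebra (f + g)
| tor_mul f g : tor_algebra f -> tor_algebra g -> tor_algebra (f * g)
| tor_sech : tor_algebra (fun u => sech u.1)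
| tor_logistic : tor_algebra (fun u => logistic u.1)
| tor_cos : tor_algebra (fun u => cos (u.2 / 2))
| tor_sin : tor_algebra (fun u => sin (u.2 / 2)).

Lemma is_derive_cos_half (t : R) :
  is_derive t 1 (fun s : R => cos (s / 2)) (- 2^-1 * sin (t / 2)).
Proof. by apply: is_derive_eq; rewrite /GRing.scale /=; ring. Qed.

Lemma is_derive_sin_half (t : R) :
  is_derive t 1 (fun s : R => sin (s / 2)) (2^-1 * cos (t / 2)).
Proof. by apply: is_derive_eq; rewrite /GRing.scale /=; ring. Qed.

Lemma tor_algebra_derive f : tor_algebra f ->
  (forall x, differentiable f x) /\ (forall v, tor_algebra ('D_v f)).
Proof.
elim=> {f} [a|f g _ [df Df] _ [dg Dg]|f g hf [df Df] hg [dg Dg]||||].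
- split=> [x|v]; first exact: differentiable_cst.
  suff -> : 'D_v (fun _ : R * R => a) = (fun _ => 0) by exact: tor_cst.
  by apply/funext => x; exact: derive_cst.
- split=> [x|v]; first exact: differentiableD.
  suff -> : 'D_v (f + g) = 'D_v f + 'D_v g by exact: tor_add.
  by apply/funext => x; apply: deriveD; exact: diff_derivable.
- split=> [x|v]; first exact: differentiableM.
  suff -> : 'D_v (f * g) = f * 'D_v g + g * 'D_v f.
    by apply: tor_add; apply: tor_mul.
  by apply/funext => x; apply: deriveM; exact: diff_derivable.
- split=> [x|v]; first by have [] := is_diff_fst_comp (is_derive_sech x.1).
  suff -> : 'D_v (fun u : R * R => sech u.1) = (fun _ => v.1 * 2^-1)
      * ((fun u => sech u.1) * ((fun _ => 1) + (fun _ => - 2) * (fun u => logistic u.1))).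
    do 2 (apply: tor_mul; first by [exact: tor_cst|exact: tor_sech]).
    apply: tor_add; first exact: tor_cst.
    by apply: tor_mul; [exact: tor_cst|exact: tor_logistic].
  apply/funext => x; have [_ /(_ v)[_ ->]] := is_diff_fst_comp (is_derive_sech x.1).
  by rewrite !fctE; ring.
- split=> [x|v]; first by have [] := is_diff_fst_comp (is_derive_logistic x.1).
  suff -> : 'D_v (fun u : R * R => logistic u.1) = (fun _ => v.1)
      * ((fun u => logistic u.1) * ((fun _ => 1) + (fun _ => - 1) * (fun u => logistic u.1))).
    do 2 (apply: tor_mul; first by [exact: tor_cst|exact: tor_logistic]).
    apply: tor_add; first exact: tor_cst.
    by apply: tor_mul; [exact: tor_cst|exact: tor_logistic].
  apply/funext => x; have [_ /(_ v)[_ ->]] := is_diff_fst_comp (is_derive_logistic x.1).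
  by rewrite !fctE; ring.
- split=> [x|v]; first by have [] := is_diff_snd_comp (is_derive_cos_half x.2).
  suff -> : 'D_v (fun u : R * R => cos (u.2 / 2)) = (fun _ => - v.2 / 2)
      * (fun u => sin (u.2 / 2)).
    by apply: tor_mul; [exact: tor_cst|exact: tor_sin].
  apply/funext => x; have [_ /(_ v)[_ ->]] := is_diff_snd_comp (is_derive_cos_half x.2).
  by rewrite !fctE; ring.
- split=> [x|v]; first by have [] := is_diff_snd_comp (is_derive_sin_half x.2).
  suff -> : 'D_v (fun u : R * R => sin (u.2 / 2)) = (fun _ => v.2 / 2)
      * (fun u => cos (u.2 / 2)).
    by apply: tor_mul; [exact: tor_cst|exact: tor_cos].
  apply/funext => x; have [_ /(_ v)[_ ->]] := is_diff_snd_comp (is_derive_sin_half x.2).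
  by rewrite !fctE; ring.
Qed.

Lemma smooth_row3_tor_algebra (f g h : R * R -> R) :
  tor_algebra f -> tor_algebra g -> tor_algebra h ->
  smooth (fun u => row3 (f u) (g u) (h u)).
Proof.
move=> hf hg hh.
pose C (F : R * R -> 'rV[R]_3) := exists f g h,
  [/\ tor_algebra f, tor_algebra g, tor_algebra h & F = fun u => row3 (f u) (g u) (h u)].
apply: (@smooth_closed R _ _ C); last by exists f, g, h.
move=> _ [{hf}f [{hg}g [{hh}h [/tor_algebra_derive[df Df] /tor_algebra_derive[dg Dg]
  /tor_algebra_derive[dh Dh] ->]]]].
split=> [x|v]; first exact: differentiable_row3.
exists ('D_v f), ('D_v g), ('D_v h); split=> //.
apply/funext => x.
have d : is_derive x v (fun u => row3 (f u) (g u) (h u))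
    (row3 ('D_v f x) ('D_v g x) ('D_v h x)).
  by apply: is_derive_row3; rewrite !coordE; under eq_fun do rewrite !coordE;
    exact/derivableP/diff_derivable.
by case: d.
Qed.

(* In the affine coordinate w = z1 / z2 of the projective line this is
   w = exp ((theta + i theta') / 2), since |w|^2 = (1 + z) / (1 - z) is the
   odds ratio exp theta. *)
Definition tor_vec (u : R * R) : 'rV[R]_3 :=
  row3 (sech u.1 * cos (u.2 / 2)) (sech u.1 * sin (u.2 / 2)) (2 * logistic u.1 - 1).

Lemma tor_vec_subproof u : dot (tor_vec u) (tor_vec u) = 1.
Proof.
rewrite dotE !coordE; have c2 := sin2cos2 (u.2 / 2); have s2 := sech_sqr u.1.
by ring: c2 s2.
Qed.

Definition tor_map (u : R * R) : S2 R := mkS2 (tor_vec_subproof u).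

Lemma smooth_tor_vec : smooth tor_vec.
Proof.
apply: smooth_row3_tor_algebra.
- by apply: tor_mul; [exact: tor_sech|exact: tor_cos].
- by apply: tor_mul; [exact: tor_sech|exact: tor_sin].
- apply: tor_add; last exact: tor_cst.
  by apply: tor_mul; [exact: tor_cst|exact: tor_logistic].
Qed.

Lemma derive_tor_vec (u a : R * R) : 'D_a tor_vec u =
  let s := sech u.1 in let l := logistic u.1 in
  let c := cos (u.2 / 2) in let d := sin (u.2 / 2) in
  row3 (2^-1 * a.1 * s * (1 - 2 * l) * c - 2^-1 * a.2 * s * d)
       (2^-1 * a.1 * s * (1 - 2 * l) * d + 2^-1 * a.2 * s * c)
       (2 * a.1 * l * (1 - l)).
Proof.
have [_ /(_ a) ds] := is_diff_fst_comp (is_derive_sech u.1).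
have [_ /(_ a) dl] := is_diff_fst_comp (is_derive_logistic u.1).
have [_ /(_ a) dc] := is_diff_snd_comp (is_derive_cos_half u.2).
have [_ /(_ a) dd] := is_diff_snd_comp (is_derive_sin_half u.2).
apply: derive_val; apply: is_derive_row3; rewrite !coordE;
  by under eq_fun do rewrite !coordE; apply: is_derive_eq;
    rewrite /GRing.scale /=; ring.
Qed.

Lemma logistic_inj : injective (@logistic R).
Proof.
move=> s t E; have e0 := expR_gt0 s; have e1 := expR_gt0 t.
apply: expR_inj.
have s1 : 1 + expR s != 0 by rewrite gt_eqF ?addr_gt0.
have t1 : 1 + expR t != 0 by rewrite gt_eqF ?addr_gt0.
move/eqP: E; rewrite /logistic eqr_div// => /eqP.
by rewrite !mulrDr !mulr1 (mulrC (expR t)) => /addIr.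
Qed.

(** The lattice generator is 4 pi because the longitude of [tor_vec] is half the fibre
    coordinate. *)
Lemma torification_tor_map n : torification n (4 * pi) tor_map.
Proof.
have p0 : pi != 0 :> R by rewrite gt_eqF// pi_gt0.
split.
- by rewrite mulf_neq0.
- exact: smooth_tor_vec.
- move=> u v; split.
    move=> /(congr1 (fun q => val q)) /= E.
    have := congr1 cz E; rewrite !coordE => Ez.
    (* The height determines the natural parameter; the horizontal coordinates then determine the
       half-angle modulo 2 pi. *)
    have uv : u.1 = v.1 by apply: logistic_inj; lra.
    have s0 : sech v.1 != 0 by rewrite gt_eqF// sech_gt0.
    have := congr1 cx E; rewrite !coordE uv => /(mulfI s0) Ec.
    have := congr1 cy E; rewrite !coordE uv => /(mulfI s0) Es.
    have : cos (v.2 / 2 - u.2 / 2) = 1.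
      by rewrite cosB Ec Es -!expr2 cos2Dsin2.
    move=> /cos_eq1_2pi_int[m mE]; exists m.
    rewrite [LHS]surjective_pairing; congr pair.
    have -> : m%:~R * (4 * pi) = 2 * (m%:~R * (2 * pi)) :> R by ring.
    by rewrite -mE; field.
  move=> [m ->]; have [mc ms] := @cos_sin_2pi_int R m.
  apply: val_inj; apply: row3P; rewrite /= !coordE//=;
  have -> : (u.2 + m%:~R * (4 * pi)) / 2 = u.2 / 2 + m%:~R * (2 * pi) by field.
    by rewrite cosD mc ms; ring.
  by rewrite sinD mc ms; ring.
- apply/seteqP; split=> [_ [u _ <-]|p /free_locusE h].
    apply/free_locusE; rewrite /= !coordE.
    have : sech u.1 != 0 by rewrite gt_eqF// sech_gt0.
    move: (sech _) => s s0; rewrite !exprMn -mulrDr cos2Dsin2 mulr1.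
    by rewrite expf_neq0.
  have hp := dot_S2 p; rewrite dotE in hp.
  move: h hp; set x := cx (val p); set y := cy (val p); set z := cz (val p) => h hp.
  have x2 := sqr_ge0 x; have y2 := sqr_ge0 y.
  have xy : 0 < x ^+ 2 + y ^+ 2 by rewrite lt_def h addr_ge0.
  have z1 : 0 < (1 + z) / 2 < 1.
    have : z ^+ 2 < 1 by lra.
    by move=> zz; apply/andP; split; nra.
  (* The log-odds of the success probability (1 + z)/2 attached to height [z]; the longitude is
     recovered next and doubled. *)
  pose th := ln (((1 + z) / 2) / (1 - (1 + z) / 2)).
  have lth : logistic th = (1 + z) / 2 by exact: logisticK.
  have sth : sech th ^+ 2 = x ^+ 2 + y ^+ 2 by rewrite sech_sqr lth; lra.
  have s0 : sech th != 0 by rewrite gt_eqF// sech_gt0.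
  have [t [ct st]] : exists t : R, cos t = x / sech th /\ sin t = y / sech th.
    by apply: exists_angle; rewrite !exprMn exprVn sth -mulrDl divff.
  exists (th, 2 * t) => //; apply: val_inj; apply: row3P; rewrite /= !coordE//=.
  + by rewrite (mulrC 2) mulfK// ct -/x; field.
  + by rewrite (mulrC 2) mulfK// st -/y; field.
  + by rewrite lth -/z; field.
- move=> u a b; rewrite fisher_binomial !derive_tor_vec /metric dotE /= !coordE.
  have c2 := sin2cos2 (u.2 / 2); have s2 := sech_sqr u.1.
  by field: c2 s2.
- move=> u a; rewrite !derive_tor_vec /J /=; apply: row3P; rewrite !coordE /=;
  have c2 := sin2cos2 (u.2 / 2); have s2 := sech_sqr u.1; by field: c2 s2.
- move=> t u; apply: val_inj; apply: row3P; rewrite /= !coordE//=;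
  have -> : (u.2 + t * (4 * pi)) / 2 = 2 * pi * t + u.2 / 2 by field.
    by rewrite cosD; ring.
  by rewrite sinD; ring.
Qed.

End Torification.

(** * The natural extension to the whole sphere, and the spectrum *)

Section NaturalExtension.
Context {R : realType}.

(** Pointwise convergence is the supremum of the topologies pulled back by the evaluations. *)
Lemma continuous_ptws (T : topologicalType) (I : Type) (f : T -> {ptws I -> R}) :
  (forall i, continuous (fun z => f z i)) -> continuous f.
Proof.
move=> cf z; apply/cvg_sup => i U [V [[W oW <-]] Wfz WU].
apply: filterS WU _; apply: (cf i z W).
exact: open_nbhs_nbhs.
Qed.

Variable n : nat.

(** This is 2^-n C(n, k) (1+z)^k (1-z)^(n-k). With 0^0 = 1 the poles give the Dirac masses at 0 and
    [n]. *)
Definition binomial_ext (p : S2 R) (k : 'I_n.+1) : R :=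
  binomial_pmf n ((1 + cz (val p)) / 2) k.

Lemma continuous_binomial_pmf (k : nat) : continuous (fun q : R => binomial_pmf n q k : R).
Proof.
move=> q; apply: cvgMn; apply: cvgM; first exact: exprn_continuous.
apply: (@continuous_comp _ _ _ (fun q : R => 1 - q) (fun x : R => x ^+ (n - k))).
  by apply: cvgB; [exact: cvg_cst|exact: cvg_id].
exact: exprn_continuous.
Qed.

Lemma cz_itv (p : S2 R) : -1 <= cz (val p) <= 1.
Proof.
have := dot_S2 p; rewrite dotE => h.
have hx := sqr_ge0 (cx (val p)); have hy := sqr_ge0 (cy (val p)).
by rewrite -ler_norml -(@expr_le1 _ 2)// real_normK ?num_real//; lra.
Qed.

Lemma closure_binomial_family (q : R) : 0 <= q <= 1 ->
  closure (@binomial_family R n : set {ptws 'I_n.+1 -> R})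
    (fun k => binomial_pmf n q k).
Proof.
move=> /andP[q0 q1] B nB.
pose pm (x : R) : {ptws 'I_n.+1 -> R} := fun k => binomial_pmf n x k.
have cpm : continuous pm.
  by apply: continuous_ptws => k; exact: continuous_binomial_pmf.
have /nbhs_ballP[e /= e0 eB] := cpm q B nB.
suff [x [x01 xe]] : exists x : R, 0 < x < 1 /\ `|q - x| < e.
  by exists (pm x); split; [exists x|exact: eB].
(* A step below [e] keeps the approximation; being at most 1/4, it stays inside (0, 1) when taken
   from either half towards the other. *)
pose d := Num.min (e / 2) (1 / 4).
have d0 : 0 < d by rewrite lt_min !divr_gt0.
have de : d < e by rewrite gt_min; apply/orP; left; lra.
have d4 : d <= 1 / 4 by rewrite ge_min lexx orbT.
have [h|h] := leP q (1 / 2).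
  by exists (q + d); split; [apply/andP; split; lra|rewrite ltr_distl; lra].
by exists (q - d); split; [apply/andP; split; lra|rewrite ltr_distl; lra].
Qed.

Lemma natural_extension_binomial_ext : natural_extension binomial_ext.
Proof.
split.
- have c1 : continuous (fun p : S2 R => cz (val p)).
    by apply: (continuous_entry (v := fun p : S2 R => val p)); exact: initial_continuous.
  have c2 : continuous (fun z : R => (1 + z) / 2).
    move=> z; apply: cvgM; last exact: cvg_cst.
    by apply: cvgD; [exact: cvg_cst|exact: cvg_id].
  apply: continuous_ptws => k p.
  apply: (@continuous_comp _ _ _ (fun p : S2 R => cz (val p))
    (fun z : R => binomial_pmf n ((1 + z) / 2) k)); first exact: c1.
  apply: (@continuous_comp _ _ _ (fun z : R => (1 + z) / 2)
    (fun q : R => binomial_pmf n q k)); first exact: c2.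
  exact: continuous_binomial_pmf.
- by move=> p; apply: closure_binomial_family; have /andP[h1 h2] := cz_itv p; lra.
- exists (4 * pi), tor_map; split; first exact: torification_tor_map.
  move=> u; apply/funext => k; rewrite binomial_exp_logistic /binomial_ext /=.
  by congr (binomial_pmf n _ k); rewrite !coordE; field.
Qed.

Lemma continuous_expectation (X : 'I_n.+1 -> R) :
  continuous (fun P : {ptws 'I_n.+1 -> R} => Defs.expectation P X).
Proof.
rewrite /Defs.expectation; apply: continuous_big => [|k _ P]; first exact: add_continuous.
apply: (@continuous_comp {ptws 'I_n.+1 -> R} R R (fun P => P k) (fun x => X k * x)).
  exact: (@proj_continuous _ (fun _ => R) k P).
exact: mulrl_continuous.
Qed.

(** The expectation is continuous for pointwise convergence, so the bounds cut out a closed set. *)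
Lemma closure_expectation (X : 'I_n.+1 -> R) (lo hi : R) :
  (forall P, @binomial_family R n P -> lo <= Defs.expectation P X <= hi) ->
  forall P, closure (@binomial_family R n : set {ptws 'I_n.+1 -> R}) P ->
    lo <= Defs.expectation P X <= hi.
Proof.
move=> h P cP.
pose D := (fun P : {ptws 'I_n.+1 -> R} => Defs.expectation P X) @^-1` `[lo, hi].
have cD : closed D.
  by apply: preimage_closed; [move=> x _; exact: continuous_expectation|exact: itv_closed].
suff : D P by rewrite /D /= in_itv.
apply: cD; apply: (closureS _ cP) => Q /h; rewrite /D /= in_itv.
by [].
Qed.

Section Spectrum.
Hypothesis n_gt0 : (0 < n)%N.

(* Since phi is onto, the values of f fill the interval of mean values of the
   binomial distributions: this determines the two extreme values of X. *)
Lemma spectral_rep_range (A : 'rV[R]_3) (d : R) K phi (X : 'I_n.+1 -> R) :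
  spectral_rep (fun p : S2 R => dot A (val p) + d) K phi X ->
  exists a b : R, (forall k, X k = a * Fstat k + b) /\
    ((b = d - Num.sqrt (dot A A) /\ b + a * n%:R = d + Num.sqrt (dot A A)) \/
     (b = d + Num.sqrt (dot A A) /\ b + a * n%:R = d - Num.sqrt (dot A A))).
Proof.
set r := Num.sqrt _; move=> [[_ cK [c [G [tG KG]]]] phiI [a [b XE]] fE].
exists a, b; split=> //.
have n0 : 0 < n%:R :> R by rewrite ltr0n.
have [_ [psi [_ _ phiK]] _ _] := connected_component_sub phiI.
have E (s : R) : Defs.expectation (@binomial_exp R n s) X = a * (n%:R * logistic s) + b.
  by apply: expectation_affine XE => k; exact: binomial_exp_logistic.
pose m := Num.min b (b + a * n%:R); pose M := Num.max b (b + a * n%:R).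
have bnd (p : S2 R) : m <= dot A (val p) + d <= M.
  rewrite fE; apply: closure_expectation; last exact: cK.
  move=> P [q [/andP[q0 q1] PE]]; rewrite (expectation_affine PE XE).
  have t0 : 0 <= n%:R * q by rewrite mulr_ge0// ltW.
  have t1 : 0 <= n%:R - n%:R * q by rewrite subr_ge0 ler_piMr// ltW.
  rewrite /m /M ge_min le_max; have [a0|/ltW a0] := leP 0 a.
    have h0 := mulr_ge0 a0 t0; have h1 := mulr_ge0 a0 t1.
    by apply/andP; split; apply/orP; [left|right]; lra.
  have h0 := mulr_le0_ge0 a0 t0; have h1 := mulr_le0_ge0 a0 t1.
  by apply/andP; split; apply/orP; [right|left]; lra.
(* Strictly intermediate values are means of genuine members of the family: [G] realises the
   required log-odds, its fibre coordinate being arbitrary, and [psi] undoes [phi]. *)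
have att y : m < y < M -> exists p : S2 R, dot A (val p) + d = y.
  move=> /andP[my yM].
  have an0 : a != 0.
    apply/eqP => a0; move: my yM; rewrite /m /M a0 mul0r addr0 minxx maxxx.
    by move=> h1 h2; have := lt_trans h1 h2; rewrite ltxx.
  have h : 0 < (y - b) / (a * n%:R) < 1.
    have [a0|a0] := ltP 0 a.
      have an : 0 < a * n%:R by rewrite mulr_gt0.
      rewrite divr_gt0//= ?ltr_pdivrMr ?mul1r//.
        by move: yM; rewrite /M lt_max; lra.
      by move: my; rewrite /m gt_min; lra.
    have an : a * n%:R < 0 by rewrite nmulr_rlt0// lt_neqAle an0.
    rewrite ltr_ndivlMr// ltr_ndivrMr// mul0r mul1r.
    by move: yM my; rewrite /M /m lt_max gt_min; lra.
  exists (psi (G (ln (((y - b) / (a * n%:R)) / (1 - (y - b) / (a * n%:R))), 0))).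
  rewrite fE phiK KG /= E logisticK//.
  by field; rewrite an0 gt_eqF.
have r0 : 0 <= r by exact: sqrtr_ge0.
have r2 : r ^+ 2 = dot A A by rewrite sqr_sqrtr// dot_ge0.
(* Cauchy-Schwarz, from the squared norm of the part of [A] orthogonal to [p]. *)
have cs (p : S2 R) : - r <= dot A (val p) <= r.
  rewrite -ler_norml -[r]ger0_norm// -ler_sqr ?nnegrE// !real_normK ?num_real//.
  have := dot_ge0 (A - dot A (val p) *: val p).
  rewrite -scaleNr dotDl !dotDr !dotZl !dotZr dot_S2 (dotC (val p) A) r2; nra.
have [p [q [pr qr]]] : exists p q : S2 R, dot A (val p) = r /\ dot A (val q) = - r.
  have [r00|rn0] := eqVneq r 0.
    have A0 : A = 0 by apply: dot_eq0; rewrite -r2 r00 expr0n.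
    exists north, north; rewrite A0 r00 oppr0.
    by rewrite (_ : 0 = (0 : R) *: (0 : 'rV[R]_3)) ?dotZl ?mul0r ?scale0r.
  have u1 : dot (r^-1 *: A) (r^-1 *: A) = 1 by rewrite dotZl dotZr -r2; field.
  have u2 : dot (- r^-1 *: A) (- r^-1 *: A) = 1 by rewrite dotZl dotZr -r2; field.
  by exists (mkS2 u1), (mkS2 u2); rewrite !val_mkS2 !dotZr -r2; split; field.
(* The bound at the maximum point gives d + r <= M. A strict inequality would make their midpoint a
   value of f, beyond the Cauchy-Schwarz bound. *)
have M1 : M = d + r.
  have /andP[_] := bnd p; rewrite pr addrC le_eqVlt => /orP[/eqP//|lt1].
  have /andP[h _] := bnd p; rewrite pr addrC in h.
  have [p' p'E] := att ((d + r + M) / 2) ltac:(apply/andP; split; lra).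
  by have /andP[_ h'] := cs p'; lra.
have m1 : m = d - r.
  have /andP[+ _] := bnd q; rewrite qr addrC le_eqVlt => /orP[/eqP//|lt1].
  have /andP[_ h] := bnd q; rewrite qr addrC in h.
  have [p' p'E] := att ((d - r + m) / 2) ltac:(apply/andP; split; lra).
  by have /andP[h' _] := cs p'; lra.
move: M1 m1; rewrite /M /m; case: (leP b (b + a * n%:R)) => h -> ->; [by left|by right].
Qed.

Lemma exists_spectral_rep (A : 'rV[R]_3) (d : R) :
  exists K phi (X : 'I_n.+1 -> R),
    spectral_rep (fun p : S2 R => dot A (val p) + d) K phi X.
Proof.
set r := Num.sqrt (dot A A).
have n0 : n%:R != 0 :> R by rewrite pnatr_eq0 -lt0n.
have r2 : r ^+ 2 = dot A A by rewrite sqr_sqrtr// dot_ge0.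
have [a [b ab]] : exists a b, forall p : S2 R,
    r * cz (val (euler_S2 a b p)) = dot A (val p).
  have [r00|rn0] := eqVneq r 0.
    have A0 : A = 0 by apply: dot_eq0; rewrite -r2 r00 expr0n.
    exists 0, 0 => p; rewrite A0 r00 mul0r.
    by rewrite (_ : 0 = (0 : R) *: (0 : 'rV[R]_3)) ?dotZl ?mul0r ?scale0r.
  have u1 : dot (r^-1 *: A) (r^-1 *: A) = 1 by rewrite dotZl dotZr -r2; field.
  have [a [b ab]] := exists_euler u1; exists a, b => p.
  by rewrite ab dotZl mulrA mulfV// mul1r.
(* The coefficients solve a n (1 + z)/2 + b = r z + d for all z. *)
exists binomial_ext, (euler_S2 a b), (fun k => 2 * r / n%:R * Fstat k + (d - r)).
split.
- exact: natural_extension_binomial_ext.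
- exact: euler_identity_component.
- by exists (2 * r / n%:R), (d - r).
- move=> p; rewrite (@expectation_affine _ n ((1 + cz (val (euler_S2 a b p))) / 2)
    _ _ (2 * r / n%:R) (d - r))//.
  by rewrite -ab; field.
Qed.

(** The increasing and the decreasing solution for the observable differ by k -> n - k, hence have
    the same image. *)
Lemma spec_affine (A : 'rV[R]_3) (d : R) :
  is_spec n (fun p : S2 R => dot A (val p) + d)
    [set x : R | exists k : nat, (k <= n)%N /\
      x = 2 / n%:R * Num.sqrt (dot A A) * (- (n%:R / 2) + k%:R) + d].
Proof.
split; first exact: exists_spectral_rep.
move=> K phi X /spectral_rep_range[a [b [XE]]].
have n0 : n%:R != 0 :> R by rewrite pnatr_eq0 -lt0n.
set r := Num.sqrt _ => h.
have rev (k : 'I_n.+1) : (rev_ord k)%:R = n%:R - k%:R :> R.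
  by rewrite /= subSS natrB// -ltnS ltn_ord.
have aE : a = 2 / n%:R * r /\ b = d - r \/ a = - (2 / n%:R * r) /\ b = d + r.
  case: h => -[hb ha]; [left|right]; split=> //; apply: (mulIf n0).
    by transitivity (2 * r); [lra|field].
  by transitivity (- 2 * r); [lra|field].
apply/seteqP; split=> [_ [k _ <-]|_ [k [kn ->]]].
  have kn : (k <= n)%N by rewrite -ltnS ltn_ord.
  rewrite XE /Fstat; case: aE => -[-> ->]; last first.
    exists (rev_ord k); split; first by rewrite /= subSS leq_subr.
    by rewrite rev; field.
  by exists k; split=> //; field.
have kn' : (k < n.+1)%N by [].
case: aE => -[aE bE].
  by exists (Ordinal kn') => //; rewrite XE /Fstat aE bE /=; field.
exists (rev_ord (Ordinal kn')) => //.
by rewrite XE /Fstat rev aE bE /=; field.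
Qed.

End Spectrum.
End NaturalExtension.

(** * Passage to the coordinate form of the statement *)

Lemma dot_row3 (R : realType) (a b c : R) (v : 'rV[R]_3) :
  dot (row3 a b c) v = a * cx v + b * cy v + c * cz v.
Proof. by rewrite dotE !coordE. Qed.

Theorem proposition6p25 (R : realType) (n : nat) (hn : (1 <= n)%N) :
  [/\ (forall f : S2 R -> R,
        kahler_function n f <->
        exists a b c d : R, forall p : S2 R,
          f p = a * cx (val p) + b * cy (val p) + c * cz (val p) + d),
      (forall a b c d : R,
        is_spec n
          (fun p : S2 R =>
            a * cx (val p) + b * cy (val p) + c * cz (val p) + d)
          [set x : R | exists k : nat, (k <= n)%N /\
            x = 2 / n%:R * Num.sqrt (a ^+ 2 + b ^+ 2 + c ^+ 2)
                * (- (n%:R / 2) + k%:R) + d]) &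
      (forall a b c : R,
        let j : R := n%:R / 2 in
        Num.sqrt (a ^+ 2 + b ^+ 2 + c ^+ 2) = j ->
        is_spec n
          (fun p : S2 R => a * cx (val p) + b * cy (val p) + c * cz (val p))
          [set x : R | exists k : nat, (k <= n)%N /\ x = - j + k%:R])].
Proof.
have spec (a b c d : R) : is_spec n
    (fun p : S2 R => a * cx (val p) + b * cy (val p) + c * cz (val p) + d)
    [set x : R | exists k : nat, (k <= n)%N /\
      x = 2 / n%:R * Num.sqrt (a ^+ 2 + b ^+ 2 + c ^+ 2) * (- (n%:R / 2) + k%:R) + d].
  have := spec_affine hn (row3 a b c) d.
  rewrite dot_row3 !coordE -!expr2.
  by under eq_fun do rewrite dot_row3.
split; last 2 first.
- exact: spec.
(* With norm j = n/2 the step 2 j / n between consecutive spectral values is 1. *)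
- move=> a b c j hj; have := spec a b c 0; rewrite hj.
  under eq_fun do rewrite addr0.
  congr is_spec; apply: eq_set => x; congr ex; apply/funext => k.
  congr (_ /\ x = _); rewrite /j; field.
  by rewrite pnatr_eq0 -lt0n.
move=> f; split=> [kf|[a [b [c [d fE]]]]].
  have [A [d fE]] := kahler_function_affine hn kf.
  exists (cx A), (cy A), (cz A), d => p; rewrite fE dotE; ring.
have -> : f = fun p : S2 R => dot (row3 a b c) (val p) + d.
  by apply/funext => p; rewrite fE dot_row3.
exact: affine_kahler_function.
Qed.
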